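(* For all $\mu_1,\mu_2,\sigma,\sigma_1,\sigma_2\in\mathcal{P}(\mathbb{R})$, $$\mathbb{A}_\sigma(\mu_1\boxplus\mu_2)=\mathbb{A}_\sigma(\mu_1)\boxplus\mathbb{A}_\sigma(\mu_2),\qquad \mathbb{A}_{\sigma_1}\circ\mathbb{A}_{\sigma_2}=\mathbb{A}_{\sigma_2\rhd\sigma_1}\ \text{on }\mathcal{P}(\mathbb{R}).$$
   Context: For $\mu\in\mathcal{P}(\mathbb{R})$, $G_\mu(z)=\int\frac{1}{z-x}\mu(dx)$ and $F_\mu=1/G_\mu$ on the upper half-plane $\mathbb{C}^+$. $F_\mu$ has a univalent left inverse $F_\mu^{-1}$ on some truncated cone $\Gamma_{\lambda,M}=\{z\in\mathbb{C}^+:|\mathrm{Re}\,z|<\lambda\mathrm{Im}\,z,\ \mathrm{Im}\,z>M\}$, and the Voiculescu transform is $\phi_\mu(z)=F_\mu^{-1}(z)-z$ there. Additive free convolution $\boxplus$: $\phi_{\mu\boxplus\nu}=\phi_\mu+\phi_\nu$ on a common cone. Additive monotone convolution $\rhd$: $F_{\mu\rhd\nu}=F_\mu\circ F_\nu$ on $\mathbb{C}^+$. Additive subordination: for $\mu,\sigma\in\mathcal{P}(\mathbb{R})$, $\mathbb{A}_\sigma(\mu)$ is the unique probability measure on $\mathbb{R}$ with $\sigma\boxplus\mu=\sigma\rhd\mathbb{A}_\sigma(\mu)$; it is characterized by $\phi_{\mathbb{A}_\sigma(\mu)}(z)=\phi_\mu(F_\sigma(z))$ on some cone $\Gamma_{\lambda,M}$.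 *)

(* Defs.v *)
From HB Require Import structures.
From mathcomp Require Import all_boot all_order all_algebra.
From mathcomp Require Import all_classical all_reals all_analysis.
From mathcomp Require Import complex.
Set Implicit Arguments. Unset Strict Implicit. Unset Printing Implicit Defensive.
Import Order.TTheory GRing.Theory Num.Theory.
Local Open Scope classical_set_scope.
Local Open Scope ring_scope.

Section FreeProb.
Context (R : realType).
Local Notation C := (complex R).

Local Notation PR := (probability R R).

Definition ReC (z : C) : R := complex.Re z.
Definition ImC (z : C) : R := complex.Im z.

(* Cauchy transform G_mu(z) = int 1/(z - x) mu(dx), written via its real and
   imaginary parts: 1/(z-x) = ((Re z - x) - i Im z)/((Re z - x)^2 + (Im z)^2). *)
Definition cauchyG (mu : PR) (z : C) : C :=
  Complex
    (Rintegral mu setT (fun x : R => (ReC z - x) / ((ReC z - x) ^+ 2 + (ImC z) ^+ 2)))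
    (- Rintegral mu setT (fun x : R => ImC z / ((ReC z - x) ^+ 2 + (ImC z) ^+ 2))).

Definition recipF (mu : PR) (z : C) : C := (cauchyG mu z)^-1.

Definition upper (z : C) : Prop := 0 < ImC z.

Definition cone (lam M : R) (z : C) : Prop :=
  0 < ImC z /\ `|ReC z| < lam * ImC z /\ M < ImC z.

Definition voiculescu (mu : PR) (lam M : R) (phi : C -> C) : Prop :=
  exists a b : R, 0 < a /\ 0 < b /\
    (forall w w', cone a b w -> cone a b w' ->
       recipF mu w = recipF mu w' -> w = w') /\
    forall z, cone lam M z ->
      cone a b (z + phi z) /\ recipF mu (z + phi z) = z.

Definition is_free_conv (mu nu rho : PR) : Prop :=
  exists lam M : R, 0 < lam /\ 0 < M /\
  exists phi_mu phi_nu phi_rho : C -> C,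
    [/\ voiculescu mu lam M phi_mu, voiculescu nu lam M phi_nu,
        voiculescu rho lam M phi_rho &
        forall z, cone lam M z -> phi_rho z = phi_mu z + phi_nu z].

Definition is_monotone_conv (mu nu rho : PR) : Prop :=
  forall z : C, upper z -> recipF rho z = recipF mu (recipF nu z).

Definition is_subord (sigma mu a : PR) : Prop :=
  exists rho : PR, is_free_conv sigma mu rho /\ is_monotone_conv sigma a rho.

End FreeProb.

(* Main.v *)
Require Import Defs.
From HB Require Import structures.
From mathcomp Require Import all_boot all_order all_algebra.
From mathcomp Require Import all_classical all_reals all_analysis.
From mathcomp Require Import measurable_realfun complex.
From mathcomp Require Import ring lra.

Set Implicit Arguments. Unset Strict Implicit. Unset Printing Implicit Defensive.
Import Order.TTheory GRing.Theory Num.Theory.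
Import numFieldNormedType.Exports.
Local Open Scope classical_set_scope.
Local Open Scope ring_scope.

(** Write [F] for the reciprocal Cauchy transform.  In truncated cones
    [F w = w + o(w)], so identities between Voiculescu transforms may be
    manipulated along the filter of sets containing a truncated cone.  If [rho]
    is the free convolution of [sigma] and [mu], and the monotone convolution of
    [sigma] and [a], then injectivity of [F_sigma] in a cone gives
    [phi_a = phi_mu o F_sigma] there; likewise
    [phi = phi_sigma + phi_nu o (id + phi_sigma)] for the monotone convolution
    of [sigma] and [nu].  Both identities of the theorem are formal consequences,
    except that the second needs a measure with reciprocal Cauchy transform
    [F_sigma o F_nu].  For finitely supported measures it is a mixture of
    spectral measures of rank-one perturbations of a diagonal matrix; in general
    it is a limit of those, obtained by Helly selection of quantile functions
    with values in the compactified line, and [F w = w + o(w)] excludes mass at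
    infinity. *)

(** * Norm, real part and imaginary part of complex numbers *)

Section ComplexNorm.
Context {R : realType}.
Implicit Types z w : R[i].

Lemma normc_ge0 z : 0 <= Normc.normc z.
Proof. by case: z => x y; exact: sqrtr_ge0. Qed.

Lemma normc_ge_Re z : `|ReC z| <= Normc.normc z.
Proof.
case: z => x y /=; rewrite -sqrtr_sqr ler_wsqrtr//= /ReC /=.
by rewrite lerDl sqr_ge0.
Qed.

Lemma normc_ge_Im z : `|ImC z| <= Normc.normc z.
Proof.
case: z => x y /=; rewrite -sqrtr_sqr ler_wsqrtr//= /ImC /=.
by rewrite lerDr sqr_ge0.
Qed.

Lemma normc_le_ReIm z : Normc.normc z <= `|ReC z| + `|ImC z|.
Proof.
case: z => x y /=; rewrite /ReC /ImC /=.
rewrite -[leRHS]ger0_norm ?addr_ge0// -sqrtr_sqr ler_wsqrtr//.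
by rewrite sqrrD !real_normK ?num_real// lerD2r lerDl mulrn_wge0// mulr_ge0.
Qed.

Lemma ReCD z w : ReC (z + w) = ReC z + ReC w. Proof. by case: z; case: w. Qed.
Lemma ImCD z w : ImC (z + w) = ImC z + ImC w. Proof. by case: z; case: w. Qed.
End ComplexNorm.

(** * Integrals of bounded functions against a probability measure *)

Section ProbabilityIntegral.
Context {d : measure_display} {T : measurableType d} {R : realType}.
Variable P : probability T R.
Implicit Types (f : T -> R) (K : R).

Lemma bounded_integrable f K : measurable_fun setT f ->
  (forall x, `|f x| <= K) -> P.-integrable setT (EFin \o f).
Proof.
move=> mf fK; apply: measurable_bounded_integrable => //.
  exact: le_lt_trans (probability_le1 P measurableT) (ltry 1).
exists (Num.max K 0); split; first exact: num_real.
by move=> y Ky x _ /=; apply: le_trans (fK x) _; rewrite ltW// (le_lt_trans _ Ky)// le_max lexx.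
Qed.

Lemma Rintegral_prob_cst r : \int[P]_x r = r.
Proof.
rewrite Rintegral_cst; last exact: measurableT.
by rewrite (_ : fine _ = 1) ?mulr1//; exact: (congr1 fine (probability_setT P)).
Qed.

(** If the integral were zero, [f] would vanish almost everywhere; as it vanishes nowhere, the whole
    space would be null. *)
Lemma Rintegral_gt0 f K : measurable_fun setT f ->
  (forall x, 0 < f x) -> (forall x, f x <= K) -> 0 < \int[P]_x f x.
Proof.
move=> mf f0 fK; rewrite lt_def Rintegral_ge0 ?andbT; last by move=> x _; exact: ltW.
have fi : P.-integrable setT (EFin \o f).
  by apply: (bounded_integrable (K := K)) => // x; rewrite gtr0_norm.
apply/eqP => I0.
have If0 : (\int[P]_x `|(EFin \o f) x|)%E = 0%E.
  under eq_integral do rewrite gee0_abs ?lee_fin ?ltW//.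
  by rewrite -[LHS]fineK ?[fine _]I0//; exact: integrable_fin_num.
have [+ _] := ae_eq_integral_abs P measurableT (measurable_int _ fi).
move=> /(_ If0)[N [mN N0 NN]]; have NT : N = setT.
  apply/seteqP; split => // x _; apply: NN => /= /(_ I) [] e.
  by have := f0 x; rewrite e ltxx.
have : P N = 1%E by rewrite NT; exact: probability_setT.
by move/eqP: N0 => /eqP ->  /eqP; rewrite eq_sym onee_eq0.
Qed.

(** Dominated convergence with a constant bound. The bound holds only for large indices, so the
    sequence is first shifted. *)
Lemma Rintegral_cvg (f_ : nat -> T -> R) f K :
  (forall n, measurable_fun setT (f_ n)) -> measurable_fun setT f ->
  {ae P, forall x, f_ n x @[n --> \oo] --> f x} ->
  (\forall n \near \oo, forall x, `|f_ n x| <= K) ->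
  (\int[P]_x f_ n x) @[n --> \oo] --> \int[P]_x f x.
Proof.
move=> mf_ mf cf [N _ fK]; rewrite -(cvg_shiftn N).
have {}fK n x : `|f_ (n + N)%N x| <= K by apply: fK; exact: leq_addl.
have [fi _ H] := @dominated_convergence _ _ _ P setT measurableT
  (fun n => EFin \o f_ (n + N)%N) (EFin \o f) (EFin \o cst K)
  ltac:(move=> n; exact/measurable_EFinP) ltac:(exact/measurable_EFinP)
  ltac:(apply: filterS cf => x cx _; apply: cvg_EFin => //; [exact: nearW|by rewrite (cvg_shiftn N (f_ ^~ x))])
  ltac:(apply: (bounded_integrable (K := `|K|)) => //)
  ltac:(apply: aeW => x n _ /=; rewrite lee_fin//).
have : [sequence (\int[P]_x (f_ (n + N)%N x)%:E)%E]_n @ \oo --> (\int[P]_x f x)%:E.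
  by rewrite /Rintegral fineK//; exact: integrable_fin_num.
by move=> /fine_cvgP[].
Qed.

Lemma Rintegral_sum_indic (I : Type) (s : seq I) (c : I -> R) (A : I -> set T) :
  (forall i, measurable (A i)) ->
  P.-integrable setT (EFin \o (fun x => \sum_(i <- s) c i * \1_(A i) x)) /\
  \int[P]_x (\sum_(i <- s) c i * \1_(A i) x) = \sum_(i <- s) c i * fine (P (A i)).
Proof.
move=> mA; have ii i : P.-integrable setT (EFin \o \1_(A i)).
  apply: (bounded_integrable (K := 1)); first exact: measurable_indic.
  by move=> x; rewrite indicE; case: (_ \in _); rewrite ?normr1 ?normr0.
have ci i : P.-integrable setT (EFin \o (fun x => c i * \1_(A i) x)).
  have := integrableZl measurableT (c i) (ii i).
  by apply: eq_integrable => // t _; rewrite /= EFinM.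
elim: s => [|i s [IH1 IH2]].
  split.
    apply: (bounded_integrable (K := 0)).
      by under eq_fun do rewrite big_nil; exact: measurable_cst.
    by move=> x; rewrite big_nil normr0.
  by under eq_Rintegral do rewrite big_nil; rewrite big_nil Rintegral_prob_cst.
split.
  have := integrableD measurableT (ci i) IH1.
  by apply: eq_integrable => // t _; rewrite /= big_cons.
under eq_Rintegral do rewrite big_cons.
rewrite big_cons RintegralD// IH2 RintegralZl//; congr (_ * _ + _).
by rewrite /Rintegral integral_indic// setIT.
Qed.

End ProbabilityIntegral.

(** * The real and imaginary kernels of the Cauchy transform *)

Section CauchyKernel.
Context {R : realType}.
Implicit Types (a b x t y : R).

(* The real and imaginary parts of 1 / ((a + i b) - x). *)
Definition kernelRe a b x := (a - x) / ((a - x) ^+ 2 + b ^+ 2).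
Definition kernelIm a b x := b / ((a - x) ^+ 2 + b ^+ 2).

Lemma sqr_add_gt0 a b : 0 < b -> 0 < a ^+ 2 + b ^+ 2.
Proof. by move=> b0; rewrite ltr_wpDl ?sqr_ge0// exprn_gt0. Qed.

Lemma continuous_sqr_sub a b : continuous (fun x => (a - x) ^+ 2 + b ^+ 2).
Proof.
move=> x; apply: cvgD; last exact: cvg_cst.
by apply: (@cvgM _ _ _ _ (fun x => a - x) (fun x => a - x));
   apply: cvgB; [exact: cvg_cst|exact: cvg_id|exact: cvg_cst|exact: cvg_id].
Qed.

Lemma measurable_kernelRe a b : 0 < b -> measurable_fun setT (kernelRe a b).
Proof.
move=> b0; apply: continuous_measurable_fun => x; apply: cvgM.
  by apply: cvgB; [exact: cvg_cst|exact: cvg_id].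
by apply: cvgV; [rewrite gt_eqF// sqr_add_gt0|exact: continuous_sqr_sub].
Qed.

Lemma measurable_kernelIm a b : 0 < b -> measurable_fun setT (kernelIm a b).
Proof.
move=> b0; apply: continuous_measurable_fun => x; apply: cvgM.
  exact: cvg_cst.
by apply: cvgV; [rewrite gt_eqF// sqr_add_gt0|exact: continuous_sqr_sub].
Qed.

Lemma kernelRe_le a b x : 0 < b -> `|kernelRe a b x| <= b^-1.
Proof.
move=> b0; rewrite normrM normfV (gtr0_norm (sqr_add_gt0 _ b0)).
rewrite ler_pdivrMr ?sqr_add_gt0// mulrC ler_pdivlMr//.
rewrite -(real_normK (num_real (a - x))); have := normr_ge0 (a - x).
(* What remains is u b <= u^2 + b^2, a consequence of (u - b / 2)^2 >= 0. *)
move: (`|a - x|) => u u0; have := sqr_ge0 (u - b / 2); have := sqr_ge0 b; nra.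
Qed.

Lemma kernelIm_gt0 a b x : 0 < b -> 0 < kernelIm a b x.
Proof. by move=> b0; rewrite divr_gt0// sqr_add_gt0. Qed.

Lemma kernelIm_le a b x : 0 < b -> kernelIm a b x <= b^-1.
Proof.
move=> b0; rewrite ler_pdivrMr ?sqr_add_gt0// mulrC ler_pdivlMr//.
by rewrite -expr2 lerDr sqr_ge0.
Qed.

End CauchyKernel.

(** * Asymptotics of the reciprocal Cauchy transform in truncated cones *)

Section ReciprocalCauchy.
Context {R : realType}.
Variable mu : probability R R.
Implicit Types (z w : R[i]) (l M e : R).

Definition cauchyRe z := \int[mu]_x kernelRe (ReC z) (ImC z) x.
Definition cauchyIm z := \int[mu]_x kernelIm (ReC z) (ImC z) x.

Lemma kernelRe_integrable z : upper z ->
  mu.-integrable setT (EFin \o kernelRe (ReC z) (ImC z)).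
Proof.
move=> z0; apply: (@bounded_integrable _ _ _ mu _ (ImC z)^-1).
  exact: measurable_kernelRe.
by move=> x; exact: kernelRe_le.
Qed.

Lemma kernelIm_integrable z : upper z ->
  mu.-integrable setT (EFin \o kernelIm (ReC z) (ImC z)).
Proof.
move=> z0; apply: (@bounded_integrable _ _ _ mu _ (ImC z)^-1).
  exact: measurable_kernelIm.
by move=> x; rewrite gtr0_norm ?kernelIm_gt0//; exact: kernelIm_le.
Qed.

Lemma cauchyIm_gt0 z : upper z -> 0 < cauchyIm z.
Proof.
move=> z0; apply: (@Rintegral_gt0 _ _ _ mu _ (ImC z)^-1).
- exact: measurable_kernelIm.
- by move=> x; exact: kernelIm_gt0.
- by move=> x; exact: kernelIm_le.
Qed.

Lemma recipFE z : recipF mu z =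
  Complex (cauchyRe z / (cauchyRe z ^+ 2 + cauchyIm z ^+ 2))
          (cauchyIm z / (cauchyRe z ^+ 2 + cauchyIm z ^+ 2)).
Proof. by rewrite /recipF /cauchyG /GRing.inv /= sqrrN mulNr opprK. Qed.

Lemma recipF_upper z : upper z -> upper (recipF mu z).
Proof.
by move=> z0; rewrite recipFE /upper /ImC /= divr_gt0 ?sqr_add_gt0 ?cauchyIm_gt0.
Qed.

(** With I = [cauchyIm w], Im F(w) <= 1 / I, so a lower bound on the product of Im w and I is
    enough. The lemma serves to show that w is high in the cone as soon as F(w) is. *)
Lemma recipF_le_Im a b : 0 < a -> 0 < b ->
  exists2 c, 0 < c & forall w, cone a b w -> ImC (recipF mu w) <= c * ImC w.
Proof.
move=> a0 b0.
(* In the cone [f] is a lower bound, independent of [w], for y^2 / ((x - t)^2 + y^2): use (x - t)^2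
   <= 2 x^2 + 2 t^2, x^2 <= a^2 y^2, and t^2 <= y^2 (t / b)^2 since y > b. *)
pose f (t : R) := (2 * a ^+ 2 + 1 + 2 * (t / b) ^+ 2)^-1.
have fpos (t : R) : 1 <= 2 * a ^+ 2 + 1 + 2 * (t / b) ^+ 2.
  by rewrite addrAC lerDr addr_ge0// mulr_ge0// sqr_ge0.
have f0 t : 0 < f t by rewrite invr_gt0 (lt_le_trans _ (fpos t)).
have f1 t : f t <= 1 by rewrite invf_le1 // (lt_le_trans _ (fpos t)).
have mf : measurable_fun setT f.
  apply: continuous_measurable_fun => t; apply: cvgV.
    by rewrite gt_eqF// (lt_le_trans _ (fpos t)).
  apply: cvgD; first exact: cvg_cst.
  apply: cvgM; first exact: cvg_cst.
  by apply: (@cvgM _ _ _ _ (fun t => t / b) (fun t => t / b));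
    apply: cvgM; [exact: cvg_id|exact: cvg_cst|exact: cvg_id|exact: cvg_cst].
have I0 : 0 < \int[mu]_t f t by exact: (Rintegral_gt0 mu mf f0 f1).
exists (\int[mu]_t f t)^-1; first by rewrite invr_gt0.
move=> w [w0 [wa wb]].
have G0 := cauchyIm_gt0 w0.
have H : \int[mu]_t f t <= ImC w * cauchyIm w.
  rewrite -RintegralZl//; last exact: kernelIm_integrable.
  apply: le_Rintegral => //.
  - by apply: (bounded_integrable mu mf (K := 1)) => x; rewrite gtr0_norm.
  - apply: (bounded_integrable mu (K := 1)).
      apply: measurable_funM => //; exact: measurable_kernelIm.
    move=> x; rewrite gtr0_norm; last exact: mulr_gt0 (kernelIm_gt0 _ _ w0).
    by rewrite mulrC -ler_pdivlMr// mul1r; exact: kernelIm_le.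
  move=> t _; rewrite /f /kernelIm mulrA -expr2 -[leLHS]mul1r.
  rewrite ler_pdivrMr ?(lt_le_trans _ (fpos t))// mulrAC ler_pdivlMr ?sqr_add_gt0//.
  rewrite mul1r; set x := ReC w; set y := ImC w.
  have h1 : x ^+ 2 <= a ^+ 2 * y ^+ 2.
    rewrite -exprMn -(real_normK (num_real x)) ler_sqr ?nnegrE//; first exact: ltW.
    by rewrite mulr_ge0// ltW.
  have h2 : t ^+ 2 <= y ^+ 2 * (t / b) ^+ 2.
    rewrite -{1}(divfK (lt0r_neq0 b0) t) exprMn mulrC.
    rewrite ler_wpM2r ?sqr_ge0// ler_sqr ?nnegrE; [exact: ltW|exact: ltW|].
    exact: ltW.
  have := sqr_ge0 (x + t); nra.
rewrite recipFE /ImC /= -/(ImC w) ler_pdivrMr ?sqr_add_gt0//.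
rewrite -mulrA ler_pdivlMl//.
apply: (@le_trans _ _ (ImC w * cauchyIm w * cauchyIm w)); first by rewrite ler_pM2r.
by rewrite -mulrA -expr2 ler_pM2l// lerDr sqr_ge0.
Qed.


(** The integrand is at most 1 and decreases to 0 as y grows: dominated convergence along y = n + 1,
    then monotonicity in y. *)
Lemma Rintegral_tail_le (K e : R) : 0 < K -> 0 < e -> exists2 M, 0 < M &
  forall y, M < y -> \int[mu]_t (t ^+ 2 / (t ^+ 2 + K * y ^+ 2)) <= e.
Proof.
move=> K0 e0.
pose f y (t : R) := t ^+ 2 / (t ^+ 2 + K * y ^+ 2).
have D0 y t : 0 < y -> 0 < t ^+ 2 + K * y ^+ 2.
  by move=> y0; rewrite ltr_wpDl ?sqr_ge0// mulr_gt0// exprn_gt0.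
have f0 y t : 0 < y -> 0 <= f y t by move=> y0; rewrite divr_ge0 ?sqr_ge0// ltW ?D0.
have f1 y t : 0 < y -> f y t <= 1.
  by move=> y0; rewrite ler_pdivrMr ?D0// mul1r lerDl ltW// mulr_gt0// exprn_gt0.
have fle (y y' t : R) : 0 < y -> y <= y' -> f y' t <= f y t.
  move=> y0 yy; have y0' := lt_le_trans y0 yy.
  rewrite ler_wpM2l ?sqr_ge0// lef_pV2 ?posrE ?D0// lerD2l ler_pM2l//.
  by rewrite ler_sqr ?nnegrE//; exact: ltW.
have mf y : 0 < y -> measurable_fun setT (f y).
  move=> y0; apply: continuous_measurable_fun => t.
  have ct : (fun t : R => t ^+ 2) x @[x --> t] --> t ^+ 2.
    by apply: (@cvgM _ _ _ _ id id); exact: cvg_id.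
  apply: cvgM => //; apply: cvgV; first by rewrite gt_eqF// D0.
  by apply: cvgD => //; exact: cvg_cst.
have fi y : 0 < y -> mu.-integrable setT (EFin \o f y).
  move=> y0; apply: (bounded_integrable mu (mf _ y0) (K := 1)) => x.
  by rewrite ger0_norm ?f0 ?f1.
have cf : (\int[mu]_t f n.+1%:R t) @[n --> \oo] --> (\int[mu]_t (cst 0 t) : R).
  apply: (Rintegral_cvg (K := 1)).
  - by move=> n; apply: mf.
  - exact: measurable_cst.
  - apply: aeW => t; apply: (@squeeze_cvgr _ _ _ _ (cst 0) (fun n => t ^+ 2 / K * harmonic n)).
    + apply: nearW => n; rewrite f0//= /f -mulrA ler_wpM2l ?sqr_ge0//.
      rewrite /harmonic/= -invfM lef_pV2 ?posrE ?D0 ?mulr_gt0//.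
      rewrite (le_trans (y := K * n.+1%:R ^+ 2))// ?lerDr ?sqr_ge0// ler_pM2l//.
      by rewrite expr2 ler_peMr// ler1n.
    + exact: cvg_cst.
    + by rewrite -[X in _ --> X](mulr0 (t ^+ 2 / K)); apply: cvgM; [exact: cvg_cst|exact: cvg_harmonic].
  - by apply: nearW => n t; rewrite ger0_norm ?f0 ?f1.
rewrite Rintegral_prob_cst in cf.
have : \forall n \near \oo, `|0 - \int[mu]_t f n.+1%:R t| < e.
  by move/cvgrPdist_lt : cf; apply.
move=> [N _ /(_ N (leqnn N))] /= HN.
exists N.+1%:R => // y Ny.
have y0 : 0 < y by rewrite (lt_trans _ Ny).
apply: (@le_trans _ _ (\int[mu]_t f N.+1%:R t)).
  apply: le_Rintegral => //; [exact: fi|exact: fi|].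
  by move=> t _; rewrite fle// ltW.
by move: HN; rewrite sub0r normrN => /ltW; apply: le_trans; exact: ler_norm.
Qed.

(** Pointwise |u| <= e / 2 + u^2 / (2 e) <= e / 2 + (K / e) g, and each of the two summands
    integrates to at most e / 2. *)
Lemma abs_Rintegral_le_sqr (u g : R -> R) (K B e : R) : 0 < K -> 0 < e ->
  measurable_fun setT u -> (forall t, `|u t| <= B) ->
  mu.-integrable setT (EFin \o g) -> (forall t, u t ^+ 2 <= 2 * K * g t) ->
  \int[mu]_t g t <= e ^+ 2 / (2 * K) -> `|\int[mu]_t u t| <= e.
Proof.
move=> K0 e0 mu_ uB gi ug Ig.
have ui := bounded_integrable mu mu_ uB.
apply: le_trans (le_normr_Rintegral _ ui) _ => //.
have ci : mu.-integrable setT (EFin \o cst (e / 2)).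
  by apply: (bounded_integrable mu (K := `|e / 2|)) => //; exact: measurable_cst.
have gi' : mu.-integrable setT (EFin \o (fun t => K / e * g t)).
  have := integrableZl measurableT (K / e) gi.
  by apply: eq_integrable => // t _; rewrite /= EFinM.
apply: (@le_trans _ _ (\int[mu]_t (e / 2 + K / e * g t))).
  apply: le_Rintegral => //.
  - exact: integrable_norm.
  - by have := integrableD measurableT ci gi'; apply: eq_integrable.
  move=> t _; rewrite -(ler_pM2l (x := 2 * e)) ?mulr_gt0//.
  have -> : 2 * e * (e / 2 + K / e * g t) = e ^+ 2 + 2 * K * g t.
    by field; rewrite gt_eqF.
  have := ug t; rewrite -(real_normK (num_real (u t))).
  have := sqr_ge0 (`|u t| - e); move: (`|u t|) (g t) => v s; nra.
rewrite RintegralD// Rintegral_prob_cst RintegralZl//.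
have : K / e * (\int[mu]_t g t) <= K / e * (e ^+ 2 / (2 * K)).
  by rewrite ler_pM2l// divr_gt0.
have -> : K / e * (e ^+ 2 / (2 * K)) = e / 2.
  by field; rewrite !gt_eqF.
by move: (K / e * _) => q; lra.
Qed.

(** w G(w) - 1 is the integral of t / (w - t). In the cone |t / (w - t)|^2 is at most a constant
    times t^2 / (t^2 + K y^2), whose integral is small for large y. *)
Lemma mul_cauchyG_near1 l e : 0 < l -> 0 < e -> exists M, forall w, cone l M w ->
  `|ReC (w * cauchyG mu w - 1)| <= e /\ `|ImC (w * cauchyG mu w - 1)| <= e.
Proof.
move=> l0 e0; pose K := 2 * (1 + l ^+ 2).
have K0 : 0 < K by rewrite mulr_gt0// addr_gt0// exprn_gt0.
have e1 : 0 < e ^+ 2 / (2 * K).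
  by apply: divr_gt0; [exact: exprn_gt0|exact: mulr_gt0].
have [M M0 HM] := Rintegral_tail_le K0 e1; exists M => w [w0 [wl wM]].
have HI := HM _ wM.
set x := ReC w in wl; set y := ImC w in w0 wl wM HI.
have D0 t : 0 < (x - t) ^+ 2 + y ^+ 2 by exact: sqr_add_gt0.
have E0 t : 0 < t ^+ 2 + K * y ^+ 2.
  by rewrite ltr_wpDl ?sqr_ge0// mulr_gt0// exprn_gt0.
have xl : x ^+ 2 <= l ^+ 2 * y ^+ 2.
  rewrite -exprMn -(real_normK (num_real x)) ler_sqr ?nnegrE//; first exact: ltW.
  by rewrite mulr_ge0// ltW.
have gi : mu.-integrable setT (EFin \o (fun t => t ^+ 2 / (t ^+ 2 + K * y ^+ 2))).
  apply: (bounded_integrable mu (K := 1)).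
    apply: continuous_measurable_fun => t.
    have ct : (fun t : R => t ^+ 2) x @[x --> t] --> t ^+ 2.
      by apply: (@cvgM _ _ _ _ id id); exact: cvg_id.
    apply: cvgM => //; apply: cvgV; first by rewrite gt_eqF// E0.
    by apply: cvgD => //; exact: cvg_cst.
  move=> t; rewrite ger0_norm ?divr_ge0 ?sqr_ge0 ?(ltW (E0 t))//.
  by rewrite ler_pdivrMr// mul1r lerDl ltW// mulr_gt0// exprn_gt0.
(* Follows from t^2 <= 2 (x - t)^2 + 2 x^2 and x^2 <= l^2 y^2; [K] is chosen to absorb both. *)
have key t : t ^+ 2 / ((x - t) ^+ 2 + y ^+ 2) <= 2 * K * (t ^+ 2 / (t ^+ 2 + K * y ^+ 2)).
  rewrite mulrCA ler_wpM2l ?sqr_ge0// -[leLHS]mul1r ler_pdivrMr// mulrAC.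
  rewrite ler_pdivlMr// mul1r /K; have := sqr_ge0 (2 * x - t); have := sqr_ge0 l.
  have := sqr_ge0 (x - t); have := sqr_ge0 y; move: xl; nra.
have bnd (u v : R) t : u ^+ 2 <= ((x - t) ^+ 2 + y ^+ 2) ->
    (t * u / ((x - t) ^+ 2 + y ^+ 2)) ^+ 2 <= 2 * K * (t ^+ 2 / (t ^+ 2 + K * y ^+ 2)).
  move=> ule; apply: le_trans (key t); rewrite expr_div_n exprMn.
  rewrite expr2 invfM mulrA ler_pM2r ?invr_gt0// ler_pdivrMr//.
  by rewrite ler_wpM2l ?sqr_ge0.
have Kg t : t ^+ 2 / (t ^+ 2 + K * y ^+ 2) <= 1.
  by rewrite ler_pdivrMr// mul1r lerDl ltW// mulr_gt0// exprn_gt0.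
have absle (v : R) : v ^+ 2 <= 2 * K -> `|v| <= 2 * K + 1.
  rewrite -(real_normK (num_real v)); have := normr_ge0 v.
  by move: (`|v|) => a a0; nra.
have mre := measurable_kernelRe x w0; have mim := measurable_kernelIm x w0.
have bk (u : R -> R) t : u t ^+ 2 <= 2 * K * (t ^+ 2 / (t ^+ 2 + K * y ^+ 2)) ->
    `|u t| <= 2 * K + 1.
  move=> h; apply: absle; apply: le_trans h _.
  by rewrite -[leRHS]mulr1 ler_wpM2l// mulr_ge0// ltW.
have cG : w * cauchyG mu w - 1 =
    Complex (\int[mu]_t (t * kernelRe x y t)) (- \int[mu]_t (t * kernelIm x y t)).
  rewrite /cauchyG -[X in Complex X _]/(cauchyRe w) -[X in Complex _ (- X)]/(cauchyIm w).
  have -> : w = Complex x y by rewrite /x /y; case: (w).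
  rewrite /cauchyRe /cauchyIm -/x -/y.
  have kr := kernelRe_integrable w0; have ki := kernelIm_integrable w0.
  have kr' : mu.-integrable setT (EFin \o (fun t => t * kernelRe x y t)).
    apply: (bounded_integrable mu (K := 2 * K + 1)).
      by apply: measurable_funM => //; exact: measurable_id.
    move=> t; apply: (bk (fun t => t * kernelRe x y t)).
    by rewrite /kernelRe mulrA; apply: bnd => //; rewrite lerDl sqr_ge0.
  have ki' : mu.-integrable setT (EFin \o (fun t => t * kernelIm x y t)).
    apply: (bounded_integrable mu (K := 2 * K + 1)).
      by apply: measurable_funM => //; exact: measurable_id.
    move=> t; apply: (bk (fun t => t * kernelIm x y t)).
    by rewrite /kernelIm mulrA; apply: bnd => //; rewrite lerDr sqr_ge0.
  have sc (c : R) (f : R -> R) : mu.-integrable setT (EFin \o f) ->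
      mu.-integrable setT (EFin \o (fun t => c * f t)).
    move=> fi; have := integrableZl measurableT c fi.
    by apply: eq_integrable => // t _; rewrite /= EFinM.
  have ad (f g : R -> R) : mu.-integrable setT (EFin \o f) ->
      mu.-integrable setT (EFin \o g) -> mu.-integrable setT (EFin \o (fun t => f t + g t)).
    by move=> fi gi1; have := integrableD measurableT fi gi1; apply: eq_integrable.
  apply/eqP; rewrite eq_complex; apply/andP; split; apply/eqP => /=.
  + rewrite mulrN opprK -!RintegralZl//; try exact: sc.
    rewrite -RintegralD//; [|exact: sc|exact: sc].
    rewrite -[X in _ - X](Rintegral_prob_cst mu) -RintegralB//; last 2 first.
    * by apply: ad; exact: sc.
    * by apply: (bounded_integrable mu (K := 1)) => // t; rewrite normr1.
    apply: eq_Rintegral => t _; rewrite /kernelRe /kernelIm.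
    by field; rewrite gt_eqF.
  + rewrite oppr0 addr0 mulrN -!RintegralZl//; try exact: sc.
    rewrite addrC -RintegralB//; [|exact: sc|exact: sc].
    rewrite -[RHS]mulN1r -RintegralZl//.
    apply: eq_Rintegral => t _; rewrite /kernelRe /kernelIm.
    by field; rewrite gt_eqF.
rewrite cG /ReC /ImC /= normrN; split.
- apply: (abs_Rintegral_le_sqr K0 e0 _ _ gi _ HI (B := 2 * K + 1)).
  + by apply: measurable_funM => //; exact: measurable_id.
  + move=> t; apply: (bk (fun t => t * kernelRe x y t)).
    by rewrite /kernelRe mulrA; apply: bnd => //; rewrite lerDl sqr_ge0.
  + by move=> t; rewrite /kernelRe mulrA; apply: bnd => //; rewrite lerDl sqr_ge0.
- apply: (abs_Rintegral_le_sqr K0 e0 _ _ gi _ HI (B := 2 * K + 1)).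
  + by apply: measurable_funM => //; exact: measurable_id.
  + move=> t; apply: (bk (fun t => t * kernelIm x y t)).
    by rewrite /kernelIm mulrA; apply: bnd => //; rewrite lerDr sqr_ge0.
  + by move=> t; rewrite /kernelIm mulrA; apply: bnd => //; rewrite lerDr sqr_ge0.
Qed.

(** F(w) - w = - (w G(w) - 1) F(w), where the first factor is small and |F(w)| is at most a multiple
    of Im w in the cone. *)
Lemma recipF_asymp_cone l e : 0 < l -> 0 < e -> exists M, forall w, cone l M w ->
  Normc.normc (recipF mu w - w) <= e * ImC w.
Proof.
(* [d] <= 1/4 gives |w G(w)| >= 1/2, hence |F(w)| <= 2 |w|. With |w| <= (l + 1) Im w, the error is
   at most 4 d (l + 1) Im w <= e Im w. *)
move=> l0 e0; pose d := Num.min (1 / 4) (e / (4 * (l + 1))).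
have l1 : 0 < 4 * (l + 1) by rewrite mulr_gt0 ?addr_gt0.
have d0 : 0 < d by rewrite lt_min !divr_gt0.
have d4 : d <= 1 / 4 by rewrite ge_min lexx.
have de : d * (4 * (l + 1)) <= e by rewrite -ler_pdivlMr// ge_min lexx orbT.
have [M HM] := mul_cauchyG_near1 l0 d0; exists M => w wc.
have [Hr Hi] := HM _ wc; have [w0 [wl _]] := wc.
have G0 : cauchyG mu w != 0.
  rewrite eq_complex /= negb_and oppr_eq0 orbC.
  by rewrite -[X in X != _]/(cauchyIm w) gt_eqF ?cauchyIm_gt0.
set G := cauchyG mu w in Hr Hi G0; rewrite /recipF -/G.
have H : Normc.normc (w * G - 1) <= 2 * d.
  by apply: le_trans (normc_le_ReIm _) _; rewrite mulr_natl mulr2n lerD.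
have -> : G^-1 - w = - ((w * G - 1) * G^-1).
  by rewrite mulrBl mulfK// mul1r opprB.
rewrite normcN Normc.normcM.
have F2 : Normc.normc G^-1 <= 2 * Normc.normc w.
  have e1 : w = (w * G) * G^-1 by rewrite mulfK.
  rewrite [X in 2 * Normc.normc X]e1 Normc.normcM mulrA ler_peMl//.
    by rewrite normc_ge0.
  have : Normc.normc (1 : R[i]) <= Normc.normc (w * G) + Normc.normc (w * G - 1).
    rewrite -[X in Normc.normc X <= _](subKr (w * G)) -(normcN (w * G - 1)).
    exact: le_normcD.
  rewrite Normc.normc1; lra.
have nw : Normc.normc w <= (l + 1) * ImC w.
  apply: le_trans (normc_le_ReIm _) _; rewrite mulrDl mul1r (gtr0_norm w0).
  by rewrite lerD2r ltW.
apply: (@le_trans _ _ (2 * d * (2 * ((l + 1) * ImC w)))).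
  apply: ler_pM => //; [exact: normc_ge0|exact: normc_ge0|].
  by apply: le_trans F2 _; rewrite ler_pM2l.
have -> : 2 * d * (2 * ((l + 1) * ImC w)) = d * (4 * (l + 1)) * ImC w by ring.
by rewrite ler_pM2r.
Qed.

End ReciprocalCauchy.

(** * The filter of truncated cones and maps asymptotic to the identity *)

Section ConeFilter.
Context {R : realType}.
Local Notation C := (complex R).
Implicit Types (z w : C) (h k phi : C -> C).

(** Opening and height are both existential, so that membership means validity on some cone. *)
Definition cone_nbhs : set_system C :=
  [set P | exists l M : R, [/\ 0 < l, 0 < M & cone l M `<=` P]].

Lemma cone_sub (l l' M M' : R) : l <= l' -> M' <= M -> 0 <= M ->
  cone l M `<=` cone l' M'.
Proof.
move=> ll' MM' M0 z [z0 [zl zM]]; split => //; split; last exact: le_lt_trans zM.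
by rewrite (lt_le_trans zl)// ler_wpM2r// ltW.
Qed.

#[global] Instance cone_nbhs_filter : Filter cone_nbhs.
Proof.
split.
- by exists 1, 1.
- move=> P Q [l [M [l0 M0 hP]]] [l' [M' [l0' M0' hQ]]].
  exists (Num.min l l'), (Num.max M M'); split.
  + by rewrite lt_min l0.
  + by rewrite lt_max M0.
  + move=> z hz; split; [apply: hP|apply: hQ]; apply: cone_sub hz;
    by rewrite ?ge_min ?le_max ?lexx ?orbT ?(ltW M0).
- move=> P Q PQ [l [M [l0 M0 hP]]]; exists l, M; split => //.
  exact: subset_trans hP PQ.
Qed.

Lemma near_cone (l M : R) : 0 < l -> \forall z \near cone_nbhs, cone l M z.
Proof.
move=> l0; exists l, (Num.max M 1); split => //.
  by rewrite lt_max ltr01 orbT.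
by apply: cone_sub; rewrite ?le_max ?lexx ?ler01 ?orbT.
Qed.

Lemma near_upper : \forall z \near cone_nbhs, upper z.
Proof.
have := @near_cone 1 1 ltr01; apply: filterS => z [] //.
Qed.

(* The cone is allowed to shrink with [e], so this is weaker than h(z) = z + o(z)
   in a fixed cone, and it is stable under composition. *)
Definition asymp_id h := forall e : R, 0 < e ->
  \forall z \near cone_nbhs, Normc.normc (h z - z) <= e * ImC z.

Lemma asymp_id_cvg h : asymp_id h -> h @ cone_nbhs --> cone_nbhs.
Proof.
move=> ash P [l [M [l0 M0 hP]]].
(* Moving a point z of [cone (l / 4) (2 * M)] by at most [e * ImC z] leaves at least half of its
   imaginary part and keeps the real part below (l / 2) Im z, so the image lies in [cone l M]. *)
pose e := Num.min (1 / 2) (l / 4).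
have e0 : 0 < e by rewrite lt_min !divr_gt0.
suff : \forall z \near cone_nbhs, P (h z) by [].
near=> z; apply: hP.
have [z0 [zl zM]] : cone (l / 4) (2 * M) z.
  by near: z; apply: near_cone; rewrite divr_gt0.
have hz : Normc.normc (h z - z) <= e * ImC z by near: z; exact: ash.
have e2 : e <= 1 / 2 by rewrite ge_min lexx.
have el : e <= l / 4 by rewrite ge_min lexx orbT.
have hR := le_trans (normc_ge_Re _) hz.
have hI := le_trans (normc_ge_Im _) hz.
have e2I : e * ImC z <= 1 / 2 * ImC z by rewrite ler_wpM2r// ltW.
have elI : e * ImC z <= l / 4 * ImC z by rewrite ler_wpM2r// ltW.
have -> : h z = z + (h z - z) by rewrite addrC subrK.
move: hR hI; set d := h z - z => hR hI.
rewrite /cone ReCD ImCD.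
move: hR hI; rewrite !ler_norml => /andP[r1 r2] /andP[i1 i2].
move: zl; rewrite ltr_norml => /andP[z1 z2].
have I1 : ImC z / 2 <= ImC z + ImC d by lra.
have L : l * (ImC z / 2) <= l * (ImC z + ImC d) by rewrite ler_pM2l.
split; first lra; split; last lra.
by rewrite ltr_norml; apply/andP; split; lra.
Unshelve. all: by end_near. Qed.

Lemma asymp_id_le_Im h : asymp_id h ->
  \forall z \near cone_nbhs, ImC (h z) <= 2 * ImC z.
Proof.
move=> ash; near=> z.
have hz : Normc.normc (h z - z) <= 1 * ImC z by near: z; exact: ash.
have -> : h z = z + (h z - z) by rewrite addrC subrK.
have := le_trans (normc_ge_Im _) hz.
rewrite ImCD mul1r; move: (ImC (h z - z)) => d.
by rewrite ler_norml => /andP[]; lra.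
Unshelve. all: by end_near. Qed.

Lemma asymp_id_comp h k : asymp_id h -> asymp_id k -> asymp_id (k \o h).
Proof.
move=> ash ask e e0; near=> z => /=.
have -> : k (h z) - z = (k (h z) - h z) + (h z - z) by rewrite addrA subrK.
apply: le_trans (le_normcD _ _) _.
have h1 : Normc.normc (h z - z) <= e / 2 * ImC z.
  by near: z; apply: ash; rewrite divr_gt0.
have h2 : Normc.normc (k (h z) - h z) <= e / 4 * ImC (h z).
  by near: z; apply: (asymp_id_cvg ash (ask (e / 4) _)); rewrite divr_gt0.
have h3 : ImC (h z) <= 2 * ImC z by near: z; exact: asymp_id_le_Im.
have h4 : e / 4 * ImC (h z) <= e / 4 * (2 * ImC z).
  by rewrite ler_pM2l// divr_gt0.
lra.
Unshelve. all: by end_near. Qed.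

Lemma asymp_id_near h k : (\forall z \near cone_nbhs, h z = k z) ->
  asymp_id h -> asymp_id k.
Proof.
move=> hk ash e e0; near=> z.
have <- : h z = k z by near: z.
by near: z; exact: ash.
Unshelve. all: by end_near. Qed.

Lemma asymp_idD phi psi : asymp_id (fun z => z + phi z) ->
  asymp_id (fun z => z + psi z) -> asymp_id (fun z => z + (phi z + psi z)).
Proof.
move=> h1 h2 e e0; near=> z.
have -> : z + (phi z + psi z) - z = (z + phi z - z) + (z + psi z - z) by ring.
apply: le_trans (le_normcD _ _) _.
have : Normc.normc (z + phi z - z) <= e / 2 * ImC z.
  by near: z; apply: h1; rewrite divr_gt0.
have : Normc.normc (z + psi z - z) <= e / 2 * ImC z.
  by near: z; apply: h2; rewrite divr_gt0.
lra.
Unshelve. all: by end_near. Qed.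

(** phi(w) = o(w) and Im h(z) <= 2 Im z, so phi(h(z)) = o(z). Applied with h = id + phi_sigma and
    with h = F_sigma. *)
Lemma asymp_id_shift phi h : asymp_id (fun z => z + phi z) -> asymp_id h ->
  asymp_id (fun z => z + phi (h z)).
Proof.
move=> h1 h2 e e0; near=> z.
have : Normc.normc (h z + phi (h z) - h z) <= e / 2 * ImC (h z).
  by near: z; apply: (asymp_id_cvg h2 (h1 (e / 2) _)); rewrite divr_gt0.
have : ImC (h z) <= 2 * ImC z by near: z; exact: asymp_id_le_Im.
rewrite -(ler_pM2l (x := e / 2)) ?divr_gt0//.
have -> : h z + phi (h z) - h z = phi (h z) by ring.
have -> : z + phi (h z) - z = phi (h z) by ring.
lra.
Unshelve. all: by end_near. Qed.

End ConeFilter.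

(** * Calculus of Voiculescu transforms along the filter of cones *)

Section Voiculescu.
Context {R : realType}.
Local Notation C := (complex R).
Implicit Types (mu nu sigma rho a : probability R R) (phi psi : C -> C).

(** Injectivity is about pairs of points, hence an explicit cone instead of [\near]. *)
Definition near_inj (F : C -> C) := exists l M : R, [/\ 0 < l, 0 < M &
  forall w w', cone l M w -> cone l M w' -> F w = F w' -> w = w'].

(** Both arguments eventually lie in the cone of injectivity, so [F] may be cancelled along the
    filter. *)
Lemma near_inj_near F (h k : C -> C) : near_inj F ->
  h @ cone_nbhs --> cone_nbhs -> k @ cone_nbhs --> cone_nbhs ->
  \forall z \near cone_nbhs, F (h z) = F (k z) -> h z = k z.
Proof.
move=> [l [M [l0 M0 inj]]] hh kk.
have H := @near_cone R l M l0.
near=> z; apply: inj; near: z.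
  exact: hh H.
exact: kk H.
Unshelve. all: by end_near. Qed.

(** A form of [voiculescu] without reference to particular cones: the asymptotics of z + phi z
    replace its membership in the cone of injectivity, and are stable under the operations below. *)
Definition is_voiculescu mu phi := [/\ near_inj (recipF mu),
  asymp_id (fun z => z + phi z) &
  \forall z \near cone_nbhs, recipF mu (z + phi z) = z].

Lemma is_voiculescu_near mu phi psi :
  (\forall z \near cone_nbhs, phi z = psi z) ->
  is_voiculescu mu phi -> is_voiculescu mu psi.
Proof.
move=> pp [h1 h2 h3]; split => //.
  by apply: asymp_id_near h2; near=> z; congr (_ + _); near: z.
near=> z.
have <- : phi z = psi z by near: z.
by near: z.
Unshelve. all: by end_near. Qed.

(** id + phi and id + psi are right inverses of F with values, eventually, in a cone where F is
    injective. *)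
Lemma is_voiculescu_unique mu phi psi :
  is_voiculescu mu phi -> is_voiculescu mu psi ->
  \forall z \near cone_nbhs, phi z = psi z.
Proof.
move=> [inj a1 i1] [_ a2 i2].
have H := near_inj_near inj (asymp_id_cvg a1) (asymp_id_cvg a2).
near=> z; apply: (@addrI _ z); near: z; apply: filterS3 H i1 i2 => z H e1 e2.
by apply: H; rewrite e1 e2.
Unshelve. all: by end_near. Qed.

(** The asymptotics of [G] make it send a small cone into the cone where [F] is injective. *)
Lemma near_inj_comp F G H : asymp_id G ->
  (forall z, upper z -> H z = F (G z)) -> near_inj F -> near_inj G -> near_inj H.
Proof.
move=> aG HFG [l1 [M1 [l10 M10 i1]]] [l2 [M2 [l20 M20 i2]]].
have : \forall z \near cone_nbhs, cone l1 M1 (G z) /\ cone l2 M2 z.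
  apply: filterI; last exact: near_cone.
  exact: (asymp_id_cvg aG (near_cone M1 l10)).
move=> [l [M [l0 M0 hs]]]; exists l, M; split=> // w w' hw hw'.
rewrite !HFG; [|by case: hw'|by case: hw].
have [a1 a2] := hs _ hw; have [b1 b2] := hs _ hw'.
by move/(i1 _ _ a1 b1)/(i2 _ _ a2 b2).
Qed.

Lemma near_inj_compr F G H :
  (forall z, upper z -> H z = F (G z)) -> near_inj H -> near_inj G.
Proof.
move=> HFG [l [M [l0 M0 i]]]; exists l, M; split=> // w w' hw hw' e.
by apply: i => //; rewrite !HFG ?e//; [case: hw'|case: hw].
Qed.

Lemma recipF_asymp mu : asymp_id (recipF mu).
Proof.
move=> e e0; have [M HM] := recipF_asymp_cone mu (@ltr01 R) e0.
by apply: filterS (near_cone M (@ltr01 R)) => w /HM.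
Qed.

(** Put w = z + phi z. Then Im z = Im F(w) <= c Im w, so w is high when z is; there F(w) - w = - phi
    z is small relative to Im w, and thus to Im z. *)
Lemma voiculescu_is_voiculescu mu (l M : R) phi : 0 < l -> 0 < M ->
  voiculescu mu l M phi -> is_voiculescu mu phi.
Proof.
move=> l0 M0 [a [b [a0 [b0 [inj inv]]]]]; split.
- by exists a, b.
- move=> e e0; pose d := Num.min (1 / 2) (e / 2).
  have d0 : 0 < d by rewrite lt_min !divr_gt0.
  have d2 : d <= 1 / 2 by rewrite ge_min lexx.
  have de : d <= e / 2 by rewrite ge_min lexx orbT.
  have [M1 HM1] := recipF_asymp_cone mu a0 d0.
  have [c c0 Hc] := recipF_le_Im mu a0 b0.
  near=> z.
  (* The height c M1 for z guarantees Im w > M1. *)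
  have zc : cone l (Num.max M (c * M1)) z by near: z; exact: near_cone.
  have [z0 [zl]] := zc; rewrite gt_max => /andP[zM zM1].
  have [wc Fw] := inv z (conj z0 (conj zl zM)).
  have := Hc _ wc; rewrite Fw => zle.
  have wM1 : M1 < ImC (z + phi z).
    by rewrite -(ltr_pM2l c0); exact: lt_le_trans zM1 zle.
  have /HM1 : cone a M1 (z + phi z) by case: wc => ? [? _].
  rewrite Fw; have -> : z - (z + phi z) = - phi z by ring.
  have -> : z + phi z - z = phi z by ring.
  rewrite normcN => H; apply: le_trans H _.
  have w0 : 0 <= ImC (z + phi z) by case: wc => /ltW.
  (* Im w <= Im z + d Im w with d <= 1/2, and the last term is absorbed on the left. *)
  have : ImC (z + phi z) <= 2 * ImC z.
    have := HM1 _ (_ : cone a M1 (z + phi z)); rewrite Fw.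
    have -> : z - (z + phi z) = - phi z by ring.
    rewrite normcN => /(_ _) H; have {}H := H ltac:(by case: wc => ? [? _]).
    have := le_trans (normc_ge_Im _) H.
    move: w0; rewrite ImCD => w0; rewrite ler_norml => /andP[_ H2].
    have : d * (ImC z + ImC (phi z)) <= 1 / 2 * (ImC z + ImC (phi z)).
      by rewrite ler_wpM2r.
    lra.
  move=> H2; apply: (@le_trans _ _ (e / 2 * ImC (z + phi z))).
    by rewrite ler_wpM2r.
  by rewrite (@le_trans _ _ (e / 2 * (2 * ImC z)))//; [rewrite ler_pM2l// divr_gt0|lra].
- by exists l, M; split => // z /inv[].
Unshelve. all: by end_near. Qed.

(** The converse on all narrow and high enough cones, so that several transforms can be placed on a
    common one. *)
Lemma is_voiculescu_voiculescu mu phi : is_voiculescu mu phi ->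
  exists l0 M0 : R, [/\ 0 < l0, 0 < M0 & forall l M, l <= l0 -> M0 <= M ->
    voiculescu mu l M phi].
Proof.
move=> [[a [b [a0 b0 inj]]] asp inv].
have H : \forall z \near cone_nbhs, cone a b (z + phi z).
  exact: (asymp_id_cvg asp (near_cone b a0)).
have [l0 [M0 [l00 M00 hs]]] := filterI H inv.
exists l0, M0; split => // l M ll MM; exists a, b; split=> //; split=> //; split=> //.
move=> z /(cone_sub ll MM (le_trans (ltW M00) MM)) /hs[].
by [].
Qed.

Lemma is_free_convP mu nu rho : is_free_conv mu nu rho <-> exists phi psi,
  [/\ is_voiculescu mu phi, is_voiculescu nu psi &
      is_voiculescu rho (fun z => phi z + psi z)].
Proof.
split.
- move=> [l [M [l0 [M0 [p1 [p2 [p3 [v1 v2 v3 e]]]]]]]]; exists p1, p2.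
  split; [exact: voiculescu_is_voiculescu v1|exact: voiculescu_is_voiculescu v2|].
  apply: (@is_voiculescu_near _ p3); last exact: voiculescu_is_voiculescu v3.
  by exists l, M.
- move=> [p1 [p2 [/is_voiculescu_voiculescu[l1 [M1 [l10 M10 h1]]]
    /is_voiculescu_voiculescu[l2 [M2 [l20 M20 h2]]]
    /is_voiculescu_voiculescu[l3 [M3 [l30 M30 h3]]]]]].
  exists (Num.min (Num.min l1 l2) l3), (Num.max (Num.max M1 M2) M3).
  rewrite !lt_min l10 l20 l30 !lt_max M10; split=> //; split=> //.
  exists p1, p2, (fun z => p1 z + p2 z).
  split=> //; [apply: h1|apply: h2|apply: h3];
    by rewrite ?ge_min ?le_max ?ge_min ?le_max ?lexx ?orbT.
Qed.

(** Inverses compose in the opposite order: F_nu sends z + phi z + psi(z + phi z) to z + phi z,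
    which F_sigma sends to z. *)
Lemma is_voiculescu_monotone sigma nu rho phi psi :
  is_monotone_conv sigma nu rho ->
  is_voiculescu sigma phi -> is_voiculescu nu psi ->
  is_voiculescu rho (fun z => phi z + psi (z + phi z)).
Proof.
move=> mc [i1 a1 e1] [i2 a2 e2].
have a3 := asymp_idD a1 (asymp_id_shift a2 a1).
split => //.
- exact: near_inj_comp (recipF_asymp nu) mc i1 i2.
- near=> z.
  rewrite mc; last by near: z; exact: (asymp_id_cvg a3 near_upper).
  rewrite addrA (_ : recipF nu _ = z + phi z); first by near: z.
  by near: z; exact: (asymp_id_cvg a1 e2).
Unshelve. all: by end_near. Qed.

(** Writing z = F_sigma(z) + phi(F_sigma(z)) gives F_sigma(F_a(z + psi(F_sigma(z)))) = F_rho(z +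
    psi(F_sigma(z))) = F_sigma(z); the outer F_sigma cancels. Injectivity of F_a comes from that of
    F_rho = F_sigma o F_a. *)
Lemma is_voiculescu_subord sigma mu rho a phi psi :
  is_monotone_conv sigma a rho -> is_voiculescu sigma phi ->
  is_voiculescu mu psi -> is_voiculescu rho (fun z => phi z + psi z) ->
  is_voiculescu a (fun z => psi (recipF sigma z)).
Proof.
move=> mc [i1 a1 e1] [i2 a2 e2] [i3 a3 e3].
have aF := recipF_asymp sigma.
have a4 := asymp_id_shift a2 aF.
split => //.
- exact: near_inj_compr mc i3.
(* The right inverse id + phi is also a left inverse: both sides have the same image under
   F_sigma. *)
- have phiF : \forall z \near cone_nbhs, recipF sigma z + phi (recipF sigma z) = z.
    have H := near_inj_near i1 (asymp_id_cvg (asymp_id_comp aF a1)) (@cvg_id _ _).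
    have e1' : \forall z \near cone_nbhs,
      recipF sigma (recipF sigma z + phi (recipF sigma z)) = recipF sigma z.
      exact: (asymp_id_cvg aF e1).
    by apply: filterS2 H e1' => z; apply.
  have H := near_inj_near i1 (asymp_id_cvg (asymp_id_comp a4 (recipF_asymp a))) (@cvg_id _ _).
  have e3' : \forall z \near cone_nbhs, recipF rho (recipF sigma z +
      (phi (recipF sigma z) + psi (recipF sigma z))) = recipF sigma z.
    exact: (asymp_id_cvg aF e3).
  have up : \forall z \near cone_nbhs, upper (z + psi (recipF sigma z)).
    exact: (asymp_id_cvg a4 near_upper).
  near=> z; apply: (near H z) => //=.
  rewrite -mc; last by near: z.
  rewrite -{1}(_ : recipF sigma z + phi (recipF sigma z) = z); last by near: z.
  by rewrite -addrA; near: z.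
Unshelve. all: by end_near. Qed.

End Voiculescu.

(** * Monotone convolution of finitely supported measures *)

Section FiniteMonotone.
Context {R : realType}.
Local Notation C := (complex R).
Local Open Scope complex_scope.
Local Open Scope sesquilinear_scope.

Lemma upper_subC_neq0 (z : C) (t : R) : upper z -> z - t%:C != 0.
Proof.
case: z => a b; rewrite /upper /ImC /= => b0.
by rewrite eq_complex /= negb_and subr0 (gt_eqF b0) orbT.
Qed.

(* Spectral measure at the vector (sqrt (p i)) of the rank-one perturbation
   diag(t) + x v v^T, by the Sherman-Morrison formula for its resolvent. *)
Lemma rank_one_perturbation n (p t : 'I_n -> R) (x : R) : (forall i, 0 <= p i) ->
  exists q lam : 'I_n -> R, [/\ forall k, 0 <= q k, \sum_k q k = \sum_i p i &
    forall z : C, upper z ->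
    let G := \sum_i (p i)%:C / (z - (t i)%:C) in 1 - x%:C * G != 0 ->
    \sum_k (q k)%:C / (z - (lam k)%:C) = G / (1 - x%:C * G)].
Proof.
move=> p0.
pose v : 'cV[C]_n := \col_i (Num.sqrt (p i))%:C.
pose A : 'M[C]_n := \matrix_(i, j) ((t i)%:C *+ (i == j) + x%:C * (v i 0 * v j 0)).
have conjR (r : R) : Num.conj (r%:C : C) = r%:C.
  by apply/CrealP; rewrite complex_real.
have vv i : v i 0 * v i 0 = (p i)%:C.
  by rewrite !mxE -rmorphM -expr2 sqr_sqrtr.
have Aherm : A \is hermsymmx.
  have Ar i j : A i j = (t i *+ (i == j) + x * (Num.sqrt (p i) * Num.sqrt (p j)))%:C.
    by rewrite !mxE rmorphD rmorphMn !rmorphM.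
  apply/is_hermitianmxP; rewrite expr0 scale1r; apply/matrixP => i j.
  rewrite [RHS]mxE [X in _ = _ X]mxE !Ar [RHS]conjR; congr (_%:C).
  by rewrite (mulrC (Num.sqrt (p j))) eq_sym; case: eqVneq => [->|].
have PA := orthomx_spectralP (hermitian_normalmx Aherm).
have PU := spectral_unitarymx A.
have Dreal := hermitian_spectral_diag_real Aherm.
move: PA PU Dreal; set P := spectralmx A; set D := spectral_diag A => PA PU Dreal.
have Punit := unitarymx_unit PU.
have PtP : P^t* *m P = 1%:M by rewrite -(invmx_unitary PU) mulVmx.
pose lam k := ReC (D 0 k).
have DE k : D 0 k = (lam k)%:C.
  by have /mxOverP/(_ 0 k)/RRe_real <- := Dreal.
have PAD : P *m A = diag_mx D *m P by rewrite {1}PA !mulmxA mulmxV// mul1mx.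
pose w := P *m v.
(* The weights are the squared moduli of the coordinates of [v] in the eigenbasis of [A]. *)
pose q k := ReC (w k 0) ^+ 2 + ImC (w k 0) ^+ 2.
have qE k : (q k)%:C = Num.conj (w k 0) * w k 0.
  by rewrite [LHS]add_Re2_Im2 normCK mulrC.
(* The unitary [P] preserves inner products, and [v] is real. *)
have dot (a : 'cV[C]_n) : \sum_k Num.conj (w k 0) * (P *m a) k 0 = \sum_i v i 0 * a i 0.
  have : (w^t* *m (P *m a)) 0 0 = (v^T *m a) 0 0.
    rewrite /w trmx_mul map_mxM mulmxA -(mulmxA _ (P^t*)) PtP mulmx1.
    congr ((_ *m _) 0 0); apply/matrixP => i j; rewrite !mxE; exact: conjR.
  rewrite !mxE => e; rewrite [LHS](_ : _ = \sum_j (w^t*) 0 j * (P *m a) j 0).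
    by rewrite e; apply: eq_bigr => i _; rewrite !mxE.
  by apply: eq_bigr => i _; rewrite [in RHS]mxE [in RHS]mxE.
exists q, lam; split.
- by move=> k; rewrite addr_ge0 ?sqr_ge0.
- apply: (@complexI R); rewrite !rmorph_sum /=.
  under eq_bigr do rewrite qE.
  by rewrite [LHS]dot; apply: eq_bigr => i _; rewrite vv.
- move=> z z0 G G1.
  pose c := (1 - x%:C * G)^-1.
  (* The Sherman-Morrison solution of (z - A) u = v. In the eigenbasis its coordinates are w_k / (z
     - lam_k), so the pairing of [v] with [u], computed in both bases, gives the formula. *)
  pose u : 'cV[C]_n := \col_i (c * (v i 0 / (z - (t i)%:C))).
  have vu : \sum_i v i 0 * u i 0 = c * G.
    rewrite /G mulr_sumr; apply: eq_bigr => i _.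
    by rewrite [u i 0]mxE mulrCA; congr (_ * _); rewrite mulrA vv.
  have uA : z *: u - A *m u = v.
    apply/matrixP => i j; rewrite ord1 {j}.
    have -> : (z *: u - A *m u) i 0 = z * u i 0 - \sum_j A i j * u j 0.
      by rewrite !mxE.
    have -> : \sum_j A i j * u j 0 = (t i)%:C * u i 0 + x%:C * v i 0 * (c * G).
      rewrite -vu mulr_sumr; transitivity (\sum_j ((t i)%:C *+ (i == j) * u j 0 +
          x%:C * v i 0 * (v j 0 * u j 0))).
        by apply: eq_bigr => j _; rewrite [A i j]mxE mulrDl !mulrA.
      rewrite big_split /=; congr (_ + _).
      rewrite (bigD1 i)//= eqxx mulr1n big1 ?addr0// => j ji.
      by rewrite eq_sym (negbTE ji) mulr0n mul0r.
    rewrite opprD addrA -mulrBl [u i 0]mxE.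
    have zt := upper_subC_neq0 (t i) z0.
    have -> : (z - (t i)%:C) * (c * (v i 0 / (z - (t i)%:C))) = c * v i 0.
      by rewrite mulrCA; congr (_ * _); rewrite mulrCA divff// mulr1.
    have -> : c * v i 0 - x%:C * v i 0 * (c * G) = c * (1 - x%:C * G) * v i 0.
      by ring.
    by rewrite mulVf// mul1r.
  have Pu k : (P *m u) k 0 = w k 0 / (z - (lam k)%:C).
    apply: (mulIf (upper_subC_neq0 (lam k) z0)).
    rewrite divfK ?upper_subC_neq0// /w -[in RHS]uA mulmxBr -scalemxAr mulmxA PAD.
    rewrite -mulmxA; move: (P *m u) => a.
    by rewrite mul_diag_mx !mxE DE -mulrBl mulrC.
  under eq_bigr do rewrite qE -mulrA -Pu.
  by rewrite dot vu mulrC.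
Qed.

Implicit Types (s : seq (R * R)) (z : C).

(* A finitely supported measure is given by its list of pairs (mass, atom). *)
Definition seq_cauchyG s z : C := \sum_(a <- s) a.1%:C / (z - a.2%:C).

Definition seq_prob s := (forall a, a \in s -> 0 <= a.1) /\ \sum_(a <- s) a.1 = 1.

Lemma seq_cauchyGE s z : seq_cauchyG s z =
  Complex (\sum_(a <- s) a.1 * kernelRe (ReC z) (ImC z) a.2)
          (- \sum_(a <- s) a.1 * kernelIm (ReC z) (ImC z) a.2).
Proof.
rewrite /seq_cauchyG; elim: s => [|a s IH]; first by rewrite !big_nil oppr0.
have inv t : (z - t%:C)^-1 =
    Complex (kernelRe (ReC z) (ImC z) t) (- kernelIm (ReC z) (ImC z) t).
  by case: z {IH} => x y; rewrite {1}/GRing.inv /= subr0.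
by rewrite !big_cons IH inv; congr Complex; rewrite /= ?mulr0 ?mul0r; ring.
Qed.

Lemma seq_cauchyG_Im_lt0 s z : seq_prob s -> upper z -> ImC (seq_cauchyG s z) < 0.
Proof.
move=> [s0 s1] z0; rewrite seq_cauchyGE /ImC /= oppr_lt0.
(* Tails of the list need not have mass one, nor even positive mass, so the induction claims strict
   positivity only under positive total mass. *)
have : 0 <= \sum_(a <- s) a.1 * kernelIm (ReC z) (ImC z) a.2 /\
    (0 < \sum_(a <- s) a.1 -> 0 < \sum_(a <- s) a.1 * kernelIm (ReC z) (ImC z) a.2).
  elim: s s0 {s1} => [|a s IH] s0; first by rewrite !big_nil.
  rewrite !big_cons; have [|h1 h2] := IH.
    by move=> b bs; apply: s0; rewrite inE bs orbT.
  have a0 : 0 <= a.1 by apply: s0; rewrite mem_head.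
  have k0 := kernelIm_gt0 (ReC z) a.2 z0.
  split; first by rewrite addr_ge0// mulr_ge0// ltW.
  move: a0; rewrite le_eqVlt => /predU1P[<-|a0]; first by rewrite mul0r !add0r.
  by move=> _; rewrite ltr_pwDl// mulr_gt0.
by case=> _; apply; rewrite s1.
Qed.

(** G / (1 - x G) = 1 / (1 / G - x), and 1 - x G is nonzero because Im G < 0. The measure found is
    the monotone convolution of the point mass at [x] with [s]. *)
Lemma rank_one_seq s (x : R) : seq_prob s -> exists2 r, seq_prob r &
  forall z, upper z -> seq_cauchyG r z = ((seq_cauchyG s z)^-1 - x%:C)^-1.
Proof.
move=> sp; have [s0 s1] := sp.
pose p i := (tnth (in_tuple s) i).1; pose t i := (tnth (in_tuple s) i).2.
have p0 i : 0 <= p i by apply: s0; exact: mem_tnth.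
have [q [lam [q0 q1 H]]] := rank_one_perturbation t x p0.
exists [seq (q k, lam k) | k <- enum 'I_(size s)].
  split; first by move=> _ /mapP[k _ ->]; exact: q0.
  by rewrite big_map big_enum /= q1 -s1 [in RHS]big_tnth.
move=> z z0; rewrite {1}/seq_cauchyG big_map big_enum /=.
have GE : seq_cauchyG s z = \sum_i (p i)%:C / (z - (t i)%:C).
  by rewrite /seq_cauchyG big_tnth.
have G0 := seq_cauchyG_Im_lt0 sp z0.
have Gn0 : seq_cauchyG s z != 0.
  by apply/eqP => e; move: G0; rewrite e /ImC /= ltxx.
have xG : 1 - x%:C * seq_cauchyG s z != 0.
  apply/eqP; move: G0; case: (seq_cauchyG s z) => a b; rewrite /ImC /= => b0.
  move=> /eqP; rewrite eq_complex /= => /andP[/eqP + /eqP].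
  rewrite !mul0r subr0 addr0 sub0r => h /eqP; rewrite oppr_eq0 mulf_eq0 (lt_eqF b0) orbF.
  by move=> /eqP x0; move: h; rewrite x0 mul0r subr0 => /eqP; rewrite oner_eq0.
move: (H _ z0); rewrite /= -GE => /(_ xG) ->.
rewrite [in RHS](_ : _ - _ = (1 - x%:C * seq_cauchyG s z) / seq_cauchyG s z).
  by rewrite invf_div.
by rewrite mulrBl mul1r mulfK.
Qed.

(** G_s(F_r(z)) is the sum of m / (F_r(z) - x) over the pairs (m, x) of [s], hence the transform of
    a mixture of the measures given by [rank_one_seq]. *)
Lemma seq_monotone s r : seq_prob s -> seq_prob r -> exists2 w, seq_prob w &
  forall z, upper z -> seq_cauchyG w z = seq_cauchyG s (seq_cauchyG r z)^-1.
Proof.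
move=> [s0 s1] rp.
(* The total mass of [s] is left arbitrary for the induction on the list. *)
suff [w [w0 w1 wG]] : exists w, [/\ forall a, a \in w -> 0 <= a.1,
    \sum_(a <- w) a.1 = \sum_(a <- s) a.1 &
    forall z, upper z -> seq_cauchyG w z = seq_cauchyG s (seq_cauchyG r z)^-1].
  by exists w => //; split => //; rewrite w1.
elim: s s0 {s1} => [|[m x] s IH] s0.
  by exists [::]; split=> // z _; rewrite /seq_cauchyG !big_nil.
have [|w [w0 w1 wG]] := IH; first by move=> a sa; apply: s0; rewrite inE sa orbT.
have m0 : 0 <= m by apply: (s0 (m, x)); rewrite mem_head.
have [v [v0 v1] vG] := rank_one_seq x rp.
exists ([seq (m * a.1, a.2) | a <- v] ++ w); split.
- move=> a; rewrite mem_cat => /orP[/mapP[b bv ->]|/w0]//=.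
  by rewrite mulr_ge0// v0.
- by rewrite big_cat big_map big_cons w1 /= -mulr_sumr v1 mulr1.
- move=> z z0; rewrite /seq_cauchyG big_cat big_map big_cons /=; congr (_ + _).
    under eq_bigr do rewrite rmorphM -mulrA.
    by rewrite -mulr_sumr; congr (_ * _); exact: vG.
  exact: wG.
Qed.

End FiniteMonotone.

(** * Approximation by finitely supported measures *)

Section Discretization.
Import HBSimple.
Context {R : realType}.
Variable nu : probability R R.
Implicit Types (z : R[i]).

Lemma cvg_kernelRe (a_ b_ x_ : nat -> R) (a b x : R) : 0 < b ->
  a_ @ \oo --> a -> b_ @ \oo --> b -> x_ @ \oo --> x ->
  kernelRe (a_ n) (b_ n) (x_ n) @[n --> \oo] --> kernelRe a b x.
Proof.
move=> b0 ca cb cx; have cab := cvgB ca cx.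
apply: cvgM; first exact: cab.
apply: cvgV; first by rewrite gt_eqF// sqr_add_gt0.
by apply: cvgD; [apply: (@cvgM _ _ _ _ (fun n => a_ n - x_ n) (fun n => a_ n - x_ n)); exact: cab|
  apply: (@cvgM _ _ _ _ b_ b_); exact: cb].
Qed.

Lemma cvg_kernelIm (a_ b_ x_ : nat -> R) (a b x : R) : 0 < b ->
  a_ @ \oo --> a -> b_ @ \oo --> b -> x_ @ \oo --> x ->
  kernelIm (a_ n) (b_ n) (x_ n) @[n --> \oo] --> kernelIm a b x.
Proof.
move=> b0 ca cb cx; have cab := cvgB ca cx.
apply: cvgM; first by [].
apply: cvgV; first by rewrite gt_eqF// sqr_add_gt0.
by apply: cvgD; [apply: (@cvgM _ _ _ _ (fun n => a_ n - x_ n) (fun n => a_ n - x_ n)); exact: cab|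
  apply: (@cvgM _ _ _ _ b_ b_); exact: cb].
Qed.

(** The n-th list is the law under [nu] of a simple function [h n], with [h n] tending to the
    identity pointwise; the sums become integrals and dominated convergence applies. The point
    [z_ n] moves because the lemma is later used at reciprocal transforms of a second
    approximation. *)
Lemma exists_seq_approximation : exists s_ : nat -> seq (R * R),
  (forall n, seq_prob (s_ n)) /\
  forall (z_ : nat -> R[i]) z, upper z -> (forall n, upper (z_ n)) ->
    ReC (z_ n) @[n --> \oo] --> ReC z -> ImC (z_ n) @[n --> \oo] --> ImC z ->
    ReC (seq_cauchyG (s_ n) (z_ n)) @[n --> \oo] --> ReC (cauchyG nu z) /\
    ImC (seq_cauchyG (s_ n) (z_ n)) @[n --> \oo] --> ImC (cauchyG nu z).
Proof.
have mid : measurable_fun setT (EFin \o (fun x : R => x)).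
  by apply/measurable_EFinP; exact: measurable_id.
have [h hcvg] := approximation_sfun measurableT mid.
have {}hcvg x : h n x @[n --> \oo] --> x.
  by have /fine_cvgP[_] := hcvg x I; exact.
have mh n : measurable_fun setT (h n) by [].
have hfin n : exists r : seq R, uniq r /\ forall x, h n x \in r.
  have /finite_seqP[r rE] := fimfunP (h n).
  exists (undup r); split; first exact: undup_uniq.
  move=> x; rewrite mem_undup; have : range (h n) (h n x) by exists x.
  by rewrite rE.
have [r_ r_P] := choice hfin.
pose A n v := h n @^-1` [set v].
have mA n v : measurable (A n v).
  by rewrite -[A n v]setTI; exact: mh.
pose s_ n := [seq (fine (nu (A n v)), v) | v <- r_ n].
have decomp n (F : R -> R) x : F (h n x) = \sum_(v <- r_ n) F v * \1_(A n v) x.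
  have [ru rh] := r_P n; rewrite (bigD1_seq (h n x))//= indicE mem_set//.
  rewrite mulr1 big1 ?addr0// => v vx; rewrite indicE memNset ?mulr0//.
  by move=> /= e; move: vx; rewrite e eqxx.
have sumE n (F : R -> R) :
    \sum_(a <- s_ n) a.1 * F a.2 = \int[nu]_x F (h n x).
  have [_ e] := @Rintegral_sum_indic _ _ _ nu _ (r_ n) F (A n) (mA n).
  rewrite big_map /=; under eq_Rintegral do rewrite decomp.
  by rewrite e; apply: eq_bigr => v _; rewrite mulrC.
exists s_; split.
  move=> n; split; first by move=> _ /mapP[v _ ->]; exact: fine_ge0.
  have := sumE n (cst 1); rewrite Rintegral_prob_cst => <-.
  by apply: eq_bigr => a _; rewrite mulr1.
move=> z_ z z0 z_0 cRe cIm.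
(* Eventually Im z_n > (Im z) / 2, which bounds all kernels uniformly. *)
have nearI : \forall n \near \oo, (ImC (z_ n))^-1 <= 2 / ImC z.
  near=> n; have zn : ImC z / 2 < ImC (z_ n).
    near: n; apply: (cvgr_gt (ImC z)) => //; rewrite ltr_pdivrMr// ltr_pMr//.
    by rewrite ltr1n.
  by rewrite -invf_div lef_pV2 ?posrE ?divr_gt0//; [exact: ltW|exact: z_0].
have mc (F : R -> R) n : measurable_fun setT F -> measurable_fun setT (fun x => F (h n x)).
  by move=> mF; exact: measurableT_comp.
split.
- under eq_cvg do rewrite seq_cauchyGE /ReC /= sumE.
  rewrite /cauchyG /ReC /=.
  apply: (Rintegral_cvg (K := 2 / ImC z)).
  + by move=> n; apply: mc; apply: measurable_kernelRe; exact: z_0.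
  + exact: measurable_kernelRe.
  + by apply: aeW => x; apply: cvg_kernelRe.
  + near=> n => x; apply: (@le_trans _ _ (ImC (z_ n))^-1); last by near: n.
    by apply: kernelRe_le; exact: z_0.
- under eq_cvg do rewrite seq_cauchyGE /ImC /= sumE.
  rewrite /cauchyG /ImC /=; apply: cvgN.
  apply: (Rintegral_cvg (K := 2 / ImC z)).
  + by move=> n; apply: mc; apply: measurable_kernelIm; exact: z_0.
  + exact: measurable_kernelIm.
  + by apply: aeW => x; apply: cvg_kernelIm.
  + near=> n => x; apply: (@le_trans _ _ (ImC (z_ n))^-1); last by near: n.
    by rewrite gtr0_norm; [apply: kernelIm_le|apply: kernelIm_gt0]; exact: z_0.
Unshelve. all: by end_near. Qed.

End Discretization.

(** * Selection of a limit of bounded monotone functions *)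

Section MonotoneSelection.
Context {R : realType}.
Implicit Types (u : R -> R).

(** For nondecreasing [u] this is continuity at [x], expressed through rational points, where the
    selected sequence is known to converge. *)
Definition rat_squeezed u (x : R) := forall e : R, 0 < e -> exists p q : rat,
  [/\ ratr p < x, x < ratr q & u (ratr q) - u (ratr p) < e].

(** The one-sided limits exist by monotonicity and boundedness, and agree by hypothesis; rationals
    close to [x] on each side do the rest. *)
Lemma rat_squeezed_not_discontinuity u x : {homo u : x y / x <= y} ->
  (forall x, `|u x| <= 1) -> ~ discontinuity u x -> rat_squeezed u x.
Proof.
move=> nd u1 nx e e0.
have cl : cvg (u y @[y --> x^'-]).
  apply: nondecreasing_at_left_is_cvgr; first by apply: nearW => y a b _ _; exact: nd.
  by apply: nearW => y; exists 1 => _ [a _ <-]; have := u1 a; rewrite ler_norml => /andP[].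
have cr : cvg (u y @[y --> x^'+]).
  apply: nondecreasing_at_right_is_cvgr; first by apply: nearW => y a b _ _; exact: nd.
  by apply: nearW => y; exists (-1) => _ [a _ <-]; have := u1 a; rewrite ler_norml => /andP[].
have lr : lim (u y @[y --> x^'-]) = lim (u y @[y --> x^'+]).
  by apply/eqP; apply: contrapT => /negP h; apply: nx.
have e2 : 0 < e / 2 by rewrite divr_gt0.
have /cvgrPdist_lt/(_ _ e2)[d /= d0 hd] : u y @[y --> x^'-] --> lim (u y @[y --> x^'-]) := cl.
have /cvgrPdist_lt/(_ _ e2)[d' /= d0' hd'] : u y @[y --> x^'+] --> lim (u y @[y --> x^'+]) := cr.
have xd : x - d < x by rewrite gtrBl.
have [p] := rat_in_itvoo xd.
rewrite in_itv /= => /andP[p1 p2].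
have xd' : x < x + d' by rewrite ltrDl.
have [q] := rat_in_itvoo xd'.
rewrite in_itv /= => /andP[q1 q2].
exists p, q; split => //.
have h1 : `|lim (u y @[y --> x^'-]) - u (ratr p)| < e / 2.
  by apply: hd => //=; rewrite ltr_norml; apply/andP; split; lra.
have h2 : `|lim (u y @[y --> x^'+]) - u (ratr q)| < e / 2.
  by apply: hd' => //=; rewrite ltr_norml; apply/andP; split; lra.
move: h1 h2; rewrite lr !ltr_norml; move: (lim _) => l.
by move=> /andP[h1 h2] /andP[h3 h4]; lra.
Qed.

Variables (u_ : nat -> R -> R).
Hypothesis u_nd : forall n, {homo u_ n : x y / x <= y}.
Hypothesis u_le1 : forall n x, `|u_ n x| <= 1.

(* Helly's selection theorem; the limit is taken along an ultrafilter first. *)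
Lemma helly_selection : exists (k_ : nat -> nat) u,
  [/\ forall n, (n <= k_ n)%N, {homo u : x y / x <= y}, forall x, `|u x| <= 1 &
    forall x, rat_squeezed u x -> u_ (k_ n) x @[n --> \oo] --> u x].
Proof.
have [U [UU subU]] := @ultraFilterLemma nat (nbhs \oo) _.
have exl x : exists l : R, `|l| <= 1 /\ u_ n x @[n --> U] --> l.
  have [|l [/= l1 cl]] := @segment_compact R (-1) 1 (u_ n x @[n --> U]) _.
    apply: (@filterE _ U) => n; rewrite /= in_itv /=; have := u_le1 n x.
    by rewrite ler_norml.
  exists l; split; first by rewrite ler_norml; move: l1; rewrite in_itv.
  move=> V nV; have [//|nUV] := in_ultra_setVsetC ((u_ ^~ x) @^-1` V) UU.
  by have [y []] := cl (~` V) V nUV nV.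
have [u uP] := choice exl.
have ucvg x : u_ n x @[n --> U] --> u x by case: (uP x).
(* An enumeration of the rationals, with value 0 at codes of no rational. *)
pose q m : rat := odflt 0 (unpickle m).
(* A diagonal choice turns the ultrafilter limit into a limit along indices [k_ n]: the first n + 1
   rationals are matched up to 1 / (n + 1). *)
have exk n : exists k, (n <= k)%N /\
    forall m, (m < n.+1)%N -> `|u (ratr (q m)) - u_ k (ratr (q m))| < n.+1%:R^-1.
  have UM M : \forall k \near U, forall m, (m < M)%N ->
      `|u (ratr (q m)) - u_ k (ratr (q m))| < n.+1%:R^-1.
    elim: M => [|M IH]; first exact: nearW.
    have n0 : 0 < n.+1%:R^-1 :> R by rewrite invr_gt0.
    have /cvgrPdist_lt/(_ _ n0) h := ucvg (ratr (q M)).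
    apply: filterS2 IH h => k h1 h2 m; rewrite ltnS leq_eqVlt => /predU1P[->//|].
    exact: h1.
  have Un : \forall k \near U, (n <= k)%N by apply: subU; exact: nbhs_infty_ge.
  by have [k [k1 k2]] := filter_ex (filterI Un (UM n.+1)); exists k.
have [k_ kP] := choice exk.
have ratcvg p : u_ (k_ n) (ratr p) @[n --> \oo] --> u (ratr p).
  apply/cvgrPdist_lt => e e0; near=> n.
  have [_ /(_ (pickle p))] := kP n; rewrite /q pickleK /= => h.
  apply: (lt_trans (h _)).
    by rewrite ltnS; near: n; exact: nbhs_infty_ge.
  by near: n; exact: near_infty_natSinv_lt (PosNum e0).
exists k_, u; split.
- by move=> n; case: (kP n).
- move=> x y xy; apply: ler_cvg_to (ucvg x) (ucvg y) _.
  by apply: nearW => n; exact: u_nd.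
- by move=> x; case: (uP x).
(* By monotonicity the values at [x] lie between those at rationals [a] < x < [b], where convergence
   is known and [u] varies by less than e / 2. *)
- move=> x sx; apply/cvgrPdist_lt => e e0.
  have e2 : 0 < e / 2 by rewrite divr_gt0.
  have [a [b [ax xb ab]]] := sx _ e2.
  have nd : {homo u : x y / x <= y}.
    move=> v y vy; apply: ler_cvg_to (ucvg v) (ucvg y) _.
    by apply: nearW => n; exact: u_nd.
  have h1 := nd _ _ (ltW ax); have h2 := nd _ _ (ltW xb).
  near=> n.
  have ca : `|u (ratr a) - u_ (k_ n) (ratr a)| < e / 2.
    by near: n; move/cvgrPdist_lt : (ratcvg a); exact.
  have cb : `|u (ratr b) - u_ (k_ n) (ratr b)| < e / 2.
    by near: n; move/cvgrPdist_lt : (ratcvg b); exact.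
  have h3 := u_nd (k_ n) (ltW ax); have h4 := u_nd (k_ n) (ltW xb).
  move: ca cb; rewrite !ltr_norml => /andP[c1 c2] /andP[c3 c4].
  by apply/andP; split; lra.
Unshelve. all: by end_near. Qed.

End MonotoneSelection.

(** * The uniform law on the unit interval *)

Section UnitInterval.
Context {R : realType}.

Definition unit_interval_prob : set (measurableTypeR R) -> \bar R :=
  mrestr (@lebesgue_measure R) (measurable_itv `[0%R, 1%R[).

HB.instance Definition _ := Measure.on unit_interval_prob.

Let unit_interval_probT : unit_interval_prob setT = 1%E.
Proof.
rewrite /unit_interval_prob /mrestr setTI lebesgue_measure_itv /= lte01.
by rewrite oppr0 adde0.
Qed.

HB.instance Definition _ :=
  Measure_isProbability.Build _ _ _ unit_interval_prob unit_interval_probT.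

Definition uniform01 : probability (measurableTypeR R) R := unit_interval_prob.

Local Notation P := uniform01.

Lemma unit_interval_prob_itv (a b : R) : 0 <= a -> a <= b -> b <= 1 ->
  fine (P [set` `[a, b[]) = b - a.
Proof.
move=> a0 ab b1; rewrite /uniform01 /= /unit_interval_prob /mrestr.
rewrite (_ : _ `&` _ = [set` `[a, b[]).
  rewrite lebesgue_measure_itv /= lte_fin; case: ltP => //= ba.
  by apply/eqP; rewrite eq_sym subr_eq0 eq_le ab ba.
apply/seteqP; split => x /=; rewrite !in_itv /=; first by case.
by move=> /andP[ax xb]; split; apply/andP; split => //; lra.
Qed.

Lemma ae_unit_interval (Q : R -> Prop) : (forall x, 0 <= x < 1 -> Q x) ->
  {ae P, forall x, Q x}.
Proof.
move=> hQ; exists (~` [set` `[0, 1[]); split; first exact: measurableC.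
  by rewrite /uniform01 /= /unit_interval_prob /mrestr setICl measure0.
move=> x /= nQ; rewrite in_itv /= => xI; exact: nQ (hQ _ xI).
Qed.

Lemma ae_unit_interval_countable (D : set R) : countable D ->
  {ae P, forall x, ~ D x}.
Proof.
move=> cD; exists D; split; first exact: countable_measurable.
  apply/eqP; rewrite eq_le measure_ge0 andbT /uniform01 /= /unit_interval_prob /mrestr.
  rewrite -(countable_lebesgue_measure0 cD) le_measure ?inE//.
  - by apply: measurableI => //; exact: countable_measurable.
  - exact: countable_measurable.
by move=> x /= /contrapT.
Qed.

#[global] Instance uniform01_ae_filter : Filter (almost_everywhere P).
Proof. exact: (ae_filter_ringOfSetsType P). Qed.

Lemma nondecreasing_ae_squeezed (u : R -> R) : {homo u : x y / x <= y} ->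
  (forall x, `|u x| <= 1) -> {ae P, forall x, rat_squeezed u x}.
Proof.
move=> nd u1.
(* The larger interval makes every point of [0, 1[ interior. *)
have ndI : {in `[-1, 2 : R] &, {homo u : x y / x <= y}} by move=> x y _ _; exact: nd.
have := ae_unit_interval_countable (discontinuity_countable ndI).
have : {ae P, forall x : R, x \in `]-1, 2[}.
  by apply: ae_unit_interval => x /andP[? ?]; rewrite in_itv /=; apply/andP; split; lra.
apply: filterS2 => x xI nD; apply: rat_squeezed_not_discontinuity => //.
by move=> dx; apply: nD; split.
Qed.

End UnitInterval.

(** * Quantile functions of finitely supported measures *)

Section Quantile.
Context {R : realType}.
Local Notation P := (@uniform01 R).
Implicit Types (l : seq (R * R)) (c x y : R).

(* The quantile function, shifted by [c], of the measure with masses and atoms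
   listed in [l] by increasing atoms; it is extended by [1] to the right. *)
Fixpoint quantile c l x : R :=
  if l is a :: l' then if x < c + a.1 then a.2 else quantile (c + a.1) l' x else 1.

(** Each atom comes with the endpoints of the half-open cell on which [quantile] takes it as
    value. *)
Fixpoint quantile_cells c l : seq (R * (R * R)) :=
  if l is a :: l' then (a.2, (c, c + a.1)) :: quantile_cells (c + a.1) l' else [::].

Lemma quantile_mem c l x : quantile c l x = 1 \/
  exists2 a, a \in l & quantile c l x = a.2.
Proof.
elim: l c => [|a l IH] c /=; first by left.
case: ifP => _; first by right; exists a; rewrite ?mem_head.
have [->|[b bl ->]] := IH (c + a.1); first by left.
by right; exists b; rewrite ?inE ?bl ?orbT.
Qed.

Lemma quantile_le1 c l x : (forall a, a \in l -> `|a.2| <= 1) -> `|quantile c l x| <= 1.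
Proof.
by move=> l1; have [->|[a al ->]] := quantile_mem c l x; rewrite ?normr1 ?l1.
Qed.

(** The final value 1 respects the order because all atoms are at most 1. *)
Lemma quantile_nd c l : (forall a, a \in l -> `|a.2| <= 1) ->
  sorted (fun a b : R * R => a.2 <= b.2) l -> {homo quantile c l : x y / x <= y}.
Proof.
move=> l1 sl x y xy; elim: l c l1 sl => [|a l IH] c l1 sl //=.
have tr : transitive (fun a b : R * R => a.2 <= b.2).
  by move=> b1 b2 b3; exact: le_trans.
have al : all (fun b => a.2 <= b.2) l by apply: (order_path_min tr sl).
case: ltP => hx; case: ltP => hy //.
- have [->|[b bl ->]] := quantile_mem (c + a.1) l y; last by move/allP : al; apply.
  by apply: le_trans (ler_norm _) _; apply: l1; rewrite mem_head.
- by move: (le_lt_trans hx (le_lt_trans xy hy)); rewrite ltxx.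
- apply: IH; last exact: path_sorted sl.
  by move=> b bl; apply: l1; rewrite inE bl orbT.
Qed.

Lemma quantile_cells_lt0 c l (F : R -> R) x : (forall a, a \in l -> 0 <= a.1) -> x < c ->
  \sum_(b <- quantile_cells c l) F b.1 * \1_[set` `[b.2.1, b.2.2[] x = 0.
Proof.
elim: l c => [|a l IH] c l0 xc /=; first by rewrite big_nil.
rewrite big_cons /= IH.
- rewrite indicE memNset ?mulr0 ?addr0//= in_itv /= => /andP[cx _].
  by have := lt_le_trans xc cx; rewrite ltxx.
- by move=> b bl; apply: l0; rewrite inE bl orbT.
- by rewrite (lt_le_trans xc)// lerDl l0// mem_head.
Qed.

Lemma quantileE c l (F : R -> R) x : (forall a, a \in l -> 0 <= a.1) ->
  c <= x < c + \sum_(a <- l) a.1 ->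
  F (quantile c l x) = \sum_(b <- quantile_cells c l) F b.1 * \1_[set` `[b.2.1, b.2.2[] x.
Proof.
elim: l c => [|a l IH] c l0.
  by rewrite big_nil addr0 => /andP[cx xc]; have := le_lt_trans cx xc; rewrite ltxx.
rewrite !big_cons /= addrA => /andP[cx xc].
have l0' : forall a, a \in l -> 0 <= a.1.
  by move=> b bl; apply: l0; rewrite inE bl orbT.
case: ltP => hx.
  rewrite quantile_cells_lt0// addr0 indicE mem_set ?mulr1//=.
  by rewrite in_itv /= cx hx.
rewrite indicE memNset ?mulr0 ?add0r; first by rewrite IH// hx xc.
by rewrite /= in_itv /= => /andP[_]; rewrite ltNge hx.
Qed.

Lemma quantile_cells_mass c l (F : R -> R) : (forall a, a \in l -> 0 <= a.1) ->
  0 <= c -> c + \sum_(a <- l) a.1 <= 1 ->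
  \sum_(b <- quantile_cells c l) F b.1 * fine (P [set` `[b.2.1, b.2.2[]) =
  \sum_(a <- l) a.1 * F a.2.
Proof.
elim: l c => [|a l IH] c l0 c0; first by rewrite !big_nil.
rewrite !big_cons /= addrA => c1.
have l0' : forall a, a \in l -> 0 <= a.1.
  by move=> b bl; apply: l0; rewrite inE bl orbT.
have a0 : 0 <= a.1 by apply: l0; rewrite mem_head.
have s0 : 0 <= \sum_(a <- l) a.1 by rewrite big_seq; apply: sumr_ge0; exact: l0'.
rewrite IH ?addr_ge0// unit_interval_prob_itv ?lerDl//.
  by rewrite addrAC subrr add0r mulrC.
by apply: le_trans c1; rewrite lerDl.
Qed.

(** The quantile function pushes the uniform law to the given measure. The step-function formula
    holds on [0, 1[, hence almost everywhere. *)
Lemma Rintegral_quantile l (F : R -> R) K : seq_prob l ->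
  (forall a, a \in l -> `|a.2| <= 1) ->
  sorted (fun a b : R * R => a.2 <= b.2) l ->
  measurable_fun setT F -> (forall x, `|F x| <= K) ->
  \int[P]_x F (quantile 0 l x) = \sum_(a <- l) a.1 * F a.2.
Proof.
move=> [l0 l1] lb sl mF FK.
have mq : measurable_fun setT (quantile 0 l).
  by apply: nondecreasing_measurable => //; exact: quantile_nd.
have [si sE] := @Rintegral_sum_indic _ _ _ P _ (quantile_cells 0 l)
  (fun b => F b.1) (fun b => [set` `[b.2.1, b.2.2[]) (fun b => measurable_itv _).
rewrite -(@quantile_cells_mass 0 l F) ?l1 ?add0r// -sE /Rintegral.
congr fine; apply: ae_eq_integral => //.
- by apply/measurable_EFinP; exact: (measurableT_comp mF mq).
- exact: measurable_int si.
apply: (@filterS _ (almost_everywhere P) _ (fun x => F (quantile 0 l x) =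
  \sum_(b <- quantile_cells 0 l) F b.1 * \1_[set` `[b.2.1, b.2.2[] x)).
  by move=> x e _; rewrite e.
apply: ae_unit_interval => x /andP[x0 x1]; apply: quantileE => //.
by rewrite l1 add0r x0.
Qed.

End Quantile.

(** * Limits of finitely supported measures on the compactified line *)

Section LimitMeasure.
Context {R : realType}.
Local Notation P := (@uniform01 R).
Implicit Types (a b t u : R) (z : R[i]).

(* The line is compactified to [-1, 1]; both points at infinity have [|u| = 1],
   where [expand] takes the junk value 0. *)
Definition compress t := t / (1 + `|t|).
Definition expand u := u / (1 - `|u|).

(** The kernels at [expand u], with numerator and denominator multiplied by (1 - |u|)^2; they extend
    continuously by 0 to |u| = 1. *)
Definition compactRe a b u :=
  (a * (1 - `|u|) - u) * (1 - `|u|) / ((a * (1 - `|u|) - u) ^+ 2 + (b * (1 - `|u|)) ^+ 2).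
Definition compactIm a b u :=
  b * (1 - `|u|) ^+ 2 / ((a * (1 - `|u|) - u) ^+ 2 + (b * (1 - `|u|)) ^+ 2).

Lemma compress_lt1 t : `|compress t| < 1.
Proof.
have t0 := normr_ge0 t.
have t1 : 0 < 1 + `|t| by rewrite ltr_pwDl.
rewrite normrM normfV (gtr0_norm t1) ltr_pdivrMr// mul1r; lra.
Qed.

Lemma compressK : cancel compress expand.
Proof.
move=> t; have t0 := normr_ge0 t.
have t1 : 0 < 1 + `|t| by rewrite ltr_pwDl.
rewrite /expand /compress normrM normfV (gtr0_norm t1).
by field; rewrite (_ : 1 + `|t| - `|t| = 1) ?oner_eq0 ?(gt_eqF t1)//; ring.
Qed.

Lemma compress_nd : {homo compress : x y / x <= y}.
Proof.
move=> x y xy; rewrite /compress.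
rewrite ler_pdivrMr; last by rewrite ltr_pwDl.
rewrite mulrAC ler_pdivlMr; last by rewrite ltr_pwDl.
have [x0|x0] := leP 0 x; have [y0|y0] := leP 0 y.
- by rewrite !ger0_norm//; nra.
- by have := le_lt_trans (le_trans x0 xy) y0; rewrite ltxx.
- by rewrite (ltr0_norm x0) (ger0_norm y0); nra.
- by rewrite !ltr0_norm//; nra.
Qed.

Lemma compact_den_neq0 a b u : 0 < b ->
  (a * (1 - `|u|) - u) ^+ 2 + (b * (1 - `|u|)) ^+ 2 != 0.
Proof.
move=> b0; rewrite paddr_eq0 ?sqr_ge0// !sqrf_eq0 negb_and mulf_eq0 (gt_eqF b0) /=.
rewrite orbC; have [s0|//] := eqVneq (1 - `|u|) 0.
rewrite s0 mulr0 sub0r oppr_eq0 /=; apply/eqP => u0.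
by move: s0; rewrite u0 normr0 subr0 => /eqP; rewrite oner_eq0.
Qed.

Lemma compactRe_expand a b u : 0 < b -> `|u| != 1 ->
  compactRe a b u = kernelRe a b (expand u).
Proof.
move=> b0 u1; have s0 : 1 - `|u| != 0 by rewrite subr_eq0 eq_sym.
have := compact_den_neq0 a u b0.
rewrite /compactRe /kernelRe /expand; move: (1 - `|u|) s0 => s s0 D0.
by field; apply/andP.
Qed.

Lemma compactIm_expand a b u : 0 < b -> `|u| != 1 ->
  compactIm a b u = kernelIm a b (expand u).
Proof.
move=> b0 u1; have s0 : 1 - `|u| != 0 by rewrite subr_eq0 eq_sym.
have := compact_den_neq0 a u b0.
rewrite /compactIm /kernelIm /expand; move: (1 - `|u|) s0 => s s0 D0.
by field; apply/andP.
Qed.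

Lemma compactRe_infty a b u : `|u| = 1 -> compactRe a b u = 0.
Proof. by move=> u1; rewrite /compactRe u1 subrr mulr0 mul0r. Qed.

Lemma compactIm_infty a b u : `|u| = 1 -> compactIm a b u = 0.
Proof. by move=> u1; rewrite /compactIm u1 subrr expr0n /= mulr0 mul0r. Qed.

Lemma compactRe_le a b u : 0 < b -> `|compactRe a b u| <= b^-1.
Proof.
move=> b0; have [u1|u1] := eqVneq `|u| 1.
  by rewrite compactRe_infty// normr0 invr_ge0 ltW.
by rewrite compactRe_expand// kernelRe_le.
Qed.

Lemma compactIm_le a b u : 0 < b -> `|compactIm a b u| <= b^-1.
Proof.
move=> b0; have [u1|u1] := eqVneq `|u| 1.
  by rewrite compactIm_infty// normr0 invr_ge0 ltW.
by rewrite compactIm_expand// gtr0_norm ?kernelIm_gt0// kernelIm_le.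
Qed.

Let cvg_s u : (1 - `|x|) @[x --> u] --> 1 - `|u|.
Proof. by apply: cvgB; [exact: cvg_cst|apply: cvg_norm; exact: cvg_id]. Qed.

Let cvg_as a u : (a * (1 - `|x|) - x) @[x --> u] --> a * (1 - `|u|) - u.
Proof. by apply: cvgB; [apply: cvgM; [exact: cvg_cst|exact: cvg_s]|exact: cvg_id]. Qed.

Let cvg_den a b u : ((a * (1 - `|x|) - x) ^+ 2 + (b * (1 - `|x|)) ^+ 2) @[x --> u] -->
  (a * (1 - `|u|) - u) ^+ 2 + (b * (1 - `|u|)) ^+ 2.
Proof.
have h : (b * (1 - `|x|)) @[x --> u] --> b * (1 - `|u|).
  by apply: cvgM; [exact: cvg_cst|exact: cvg_s].
apply: cvgD.
  by apply: (@cvgM _ _ _ _ (fun x => a * (1 - `|x|) - x) (fun x => a * (1 - `|x|) - x));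
    exact: cvg_as.
by apply: (@cvgM _ _ _ _ (fun x => b * (1 - `|x|)) (fun x => b * (1 - `|x|))).
Qed.

Lemma compactRe_continuous a b : 0 < b -> continuous (compactRe a b).
Proof.
move=> b0 u; apply: cvgM; last by apply: cvgV; [exact: compact_den_neq0|exact: cvg_den].
by apply: cvgM; [exact: cvg_as|exact: cvg_s].
Qed.

Lemma compactIm_continuous a b : 0 < b -> continuous (compactIm a b).
Proof.
move=> b0 u; apply: cvgM; last by apply: cvgV; [exact: compact_den_neq0|exact: cvg_den].
apply: cvgM; first exact: cvg_cst.
by apply: (@cvgM _ _ _ _ (fun x => 1 - `|x|) (fun x => 1 - `|x|)); exact: cvg_s.
Qed.

Lemma measurable_inv : measurable_fun setT (fun x : R => x^-1).
Proof.
rewrite -(setUv [set 0 : R]); apply/measurable_funU => //.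
  exact: measurableC.
split; first exact: measurable_fun_set1.
apply: open_continuous_measurable_fun.
  by apply: closed_openC; exact: closed_eq.
by move=> x; rewrite inE /= => /eqP x0; apply: cvgV.
Qed.

Lemma measurable_expand : measurable_fun setT expand.
Proof.
apply: measurable_funM; first exact: measurable_id.
apply: (measurableT_comp measurable_inv); apply: measurable_funB => //.
Qed.

Lemma Rintegral_compactE (F G : R -> R) (K : R) (s : seq (R * R)) : seq_prob s ->
  let l := [seq (p.1, compress p.2) | p <- sort (fun p q : R * R => p.2 <= q.2) s] in
  measurable_fun setT F -> (forall x, `|F x| <= K) ->
  (forall t, F (compress t) = G t) ->
  \int[P]_x F (quantile 0 l x) = \sum_(p <- s) p.1 * G p.2.
Proof.
move=> [s0 s1] l mF FK FG.
have sE (H : R * R -> R) :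
    \sum_(p <- sort (fun p q : R * R => p.2 <= q.2) s) H p = \sum_(p <- s) H p.
  by apply: perm_big; rewrite perm_sort.
rewrite (Rintegral_quantile (K := K))//.
- rewrite big_map /= -sE; apply: eq_bigr => a _; by rewrite FG.
- split; first by move=> _ /mapP[a + ->] /=; rewrite mem_sort; exact: s0.
  by rewrite big_map /= (sE fst).
- by move=> _ /mapP[a _ ->] /=; exact: ltW (compress_lt1 _).
- rewrite sorted_map; apply: (@sub_sorted _ (fun p q : R * R => p.2 <= q.2)).
    by move=> a b; exact: compress_nd.
  by apply: sort_sorted => a b; exact: le_total.
Qed.

(** Helly selection gives a limit [u] of the compressed quantile functions. The extended kernels are
    continuous, so their integrals along [u] are the parts of 1 / H; [asymp_id H] excludes |u| = 1,
    and the law of [expand] o [u] is the measure sought. *)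
Lemma exists_limit_measure (w_ : nat -> seq (R * R)) (H : R[i] -> R[i]) :
  (forall n, seq_prob (w_ n)) -> asymp_id H ->
  (forall z, upper z ->
     ReC (seq_cauchyG (w_ n) z) @[n --> \oo] --> ReC (H z)^-1 /\
     ImC (seq_cauchyG (w_ n) z) @[n --> \oo] --> ImC (H z)^-1) ->
  exists rho : probability R R, forall z, upper z -> cauchyG rho z = (H z)^-1.
Proof.
move=> wp asH wH.
pose l_ n := [seq (p.1, compress p.2) | p <- sort (fun p q : R * R => p.2 <= q.2) (w_ n)].
have l1 n (p : R * R) : p \in l_ n -> `|p.2| <= 1.
  by move=> /mapP[b _ ->] /=; exact: ltW (compress_lt1 _).
have u_nd n : {homo quantile 0 (l_ n) : x y / x <= y}.
  apply: quantile_nd; first exact: l1.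
  rewrite sorted_map; apply: (@sub_sorted _ (fun p q : R * R => p.2 <= q.2)).
    by move=> a b; exact: compress_nd.
  by apply: sort_sorted => a b; exact: le_total.
have u_le1 n x : `|quantile 0 (l_ n) x| <= 1 by apply: quantile_le1; exact: l1.
have [k_ [u [kn und ule1 ucvg]]] := helly_selection u_nd u_le1.
have kcvg : k_ @ \oo --> \oo.
  move=> A [N _ hA]; exists N => // n /= Nn; apply: hA => /=.
  exact: leq_trans Nn (kn n).
have mu_ : measurable_fun setT u by exact: nondecreasing_measurable.
have mun n : measurable_fun setT (quantile 0 (l_ n)) by exact: nondecreasing_measurable.
have lim (F G : R -> R) K L : continuous F -> (forall x, `|F x| <= K) ->
    (forall t, F (compress t) = G t) ->
    \sum_(p <- w_ n) p.1 * G p.2 @[n --> \oo] --> L -> \int[P]_x F (u x) = L.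
  move=> cF FK FG cL; have mF : measurable_fun setT F by exact: continuous_measurable_fun.
  have c1 : \int[P]_x F (quantile 0 (l_ (k_ n)) x) @[n --> \oo] --> \int[P]_x F (u x).
    apply: (Rintegral_cvg (K := K)).
    - by move=> n; exact: (measurableT_comp mF (mun _)).
    - exact: (measurableT_comp mF mu_).
    - apply: filterS (nondecreasing_ae_squeezed und ule1) => x sx.
      exact: (cvg_comp _ _ (ucvg x sx) (cF (u x))).
    - exact: nearW.
  have c2 : \int[P]_x F (quantile 0 (l_ (k_ n)) x) @[n --> \oo] --> L.
    under eq_cvg do rewrite (Rintegral_compactE (wp _) mF FK FG).
    exact: (cvg_comp _ _ kcvg cL).
  by rewrite -(cvg_lim (@Rhausdorff R) c1); exact: cvg_lim.
have compN1 t : `|compress t| != 1 by rewrite lt_eqF ?compress_lt1.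
have limRe z : upper z -> \int[P]_x compactRe (ReC z) (ImC z) (u x) = ReC (H z)^-1.
  move=> z0; apply: (lim _ (kernelRe (ReC z) (ImC z)) (ImC z)^-1).
  - exact: compactRe_continuous.
  - by move=> x; exact: compactRe_le.
  - by move=> t; rewrite compactRe_expand// compressK.
  - have [+ _] := wH z z0; apply: cvg_trans; apply: near_eq_cvg; apply: nearW => n.
    by rewrite seq_cauchyGE.
have limIm z : upper z -> \int[P]_x compactIm (ReC z) (ImC z) (u x) = - ImC (H z)^-1.
  move=> z0; apply: (lim _ (kernelIm (ReC z) (ImC z)) (ImC z)^-1).
  - exact: compactIm_continuous.
  - by move=> x; exact: compactIm_le.
  - by move=> t; rewrite compactIm_expand// compressK.
  - have e n : \sum_(p <- w_ n) p.1 * kernelIm (ReC z) (ImC z) p.2 =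
        - ImC (seq_cauchyG (w_ n) z) by rewrite seq_cauchyGE /ImC /= opprK.
    by under eq_cvg do rewrite e; apply: cvgN; case: (wH z z0).
pose N := [set x | `|u x| = 1].
have mN : measurable (N : set (measurableTypeR R)).
  have -> : N = (fun x => `|u x|) @^-1` [set 1] by [].
  have mnu : measurable_fun setT (fun x : R => `|u x|) by exact: measurableT_comp.
  by rewrite -[X in measurable X]setTI; exact: mnu.
have N0 : P N = 0%E.
  have PNfin : P N \is a fin_num by exact: fin_num_measure.
  have iN := @Rintegral_sum_indic _ _ _ P _ [:: tt] (fun=> 1) (fun=> N) (fun=> mN).
  (* y times [compactIm 0 y] is 0 on |u| = 1 and at most 1 elsewhere; its integral is - y Im (1 /
     H(i y)). *)
  have ub y : 0 < y -> fine (P N) <= 1 + y * ImC (H (Complex 0 y))^-1.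
    move=> y0; have z0 : upper (Complex 0 y) by [].
    have := limIm _ z0; rewrite /ReC /= => e.
    have -> : y * ImC (H (Complex 0 y))^-1 = - (y * \int[P]_x compactIm 0 y (u x)).
      by rewrite e mulrN opprK.
    have ci : P.-integrable setT (EFin \o (fun x => compactIm 0 y (u x))).
      have mc : measurable_fun setT (compactIm 0 y).
        by apply: continuous_measurable_fun; exact: compactIm_continuous.
      have mcu : measurable_fun setT (fun x : measurableTypeR R => compactIm 0 y (u x)).
        exact: (measurableT_comp mc mu_).
      by apply: (bounded_integrable P mcu (K := y^-1)) => x; exact: compactIm_le.
    have yci : P.-integrable setT (EFin \o (fun x => y * compactIm 0 y (u x))).
      have := integrableZl measurableT y ci.
      by apply: eq_integrable => // t _; rewrite /= EFinM.
    have [iN1 iN2] := iN; rewrite big_seq1 mul1r in iN2.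
    rewrite -RintegralZl// -iN2 lerBrDr -RintegralD// -[leRHS](Rintegral_prob_cst P).
    apply: le_Rintegral => //.
    - by have := integrableD measurableT iN1 yci; apply: eq_integrable.
    - by apply: (bounded_integrable P (K := 1)) => // t; rewrite normr1.
    move=> x _; rewrite big_seq1 mul1r indicE.
    have [xN|xN] := boolP (x \in N).
      by rewrite compactIm_infty ?mulr0 ?addr0//; move: xN; rewrite inE.
    rewrite add0r mulrC -ler_pdivlMr// mul1r.
    exact: le_trans (ler_norm _) (compactIm_le _ _ y0).
  apply/eqP; rewrite -(fineK PNfin) eqe eq_le fine_ge0 ?measure_ge0// andbT.
  apply/ler_addgt0Pr => e e0; rewrite add0r.
  pose d := Num.min (1 / 2) (e / 2).
  have d0 : 0 < d by rewrite lt_min !divr_gt0.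
  have d2 : d <= 1 / 2 by rewrite ge_min lexx.
  have de : d <= e / 2 by rewrite ge_min lexx orbT.
  have [l [M [l0 M0 hM]]] := asH _ d0.
  pose y := M + 1; have y0 : 0 < y by rewrite addr_gt0.
  have zc : cone l M (Complex 0 y).
    split=> //; split; rewrite /ReC /ImC /= ?normr0 ?mulr_gt0// ltrDl//.
  have hd := hM _ zc; apply: le_trans (ub _ y0) _.
  set h := H (Complex 0 y) in hd *.
  have hI : y / 2 <= ImC h.
    have := le_trans (normc_ge_Im _) hd.
    have -> : ImC (h - Complex 0 y) = ImC h - y by case: h {hd}.
    have : d * y <= 1 / 2 * y by rewrite ler_pM2r.
    by rewrite {2}/ImC /= ler_norml => dy /andP[]; lra.
  have hn : 0 < Normc.normc h.
    apply: lt_le_trans (normc_ge_Im h); rewrite normr_gt0 gt_eqF//.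
    by apply: lt_le_trans hI; rewrite divr_gt0.
  have h0 : h != 0.
    by apply: contraTneq hn => ->; rewrite Normc.normc0 ltxx.
  (* The bound on the mass at infinity is thus at most |h - i y| / |h| <= d y / (y / 2) = 2 d <=
     e. *)
  have -> : 1 + y * ImC h^-1 = ReC ((h - Complex 0 y) * h^-1).
    rewrite mulrBl divff//; case: (h^-1) => p q.
    by rewrite /ReC /ImC /= mul0r sub0r opprK.
  apply: le_trans (le_trans (ler_norm _) (normc_ge_Re _)) _.
  rewrite Normc.normcM Normc.normcV ler_pdivrMr//.
  apply: le_trans hd _; rewrite {1}/ImC /=.
  have hy : y / 2 <= Normc.normc h.
    by apply: le_trans (le_trans hI (ler_norm _)) (normc_ge_Im h).
  apply: (@le_trans _ _ (e / 2 * y)); first by rewrite ler_pM2r.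
  by rewrite -mulrA (mulrC _ y) ler_pM2l.
have mX : measurable_fun setT (fun x : measurableTypeR R => expand (u x)).
  exact: (measurableT_comp measurable_expand mu_).
pose X : {mfun measurableTypeR R >-> R} := mfun_Sub (mem_set mX).
pose rho : probability R R := distribution P X.
have aeN : {ae P, forall x, `|u x| != 1}.
  exists N; split => // x /= /negP; rewrite negbK => /eqP //.
(* [F'] need match [F] only off |t| = 1, since [u] avoids these values almost surely. *)
have Idist (F F' : R -> R) K : measurable_fun setT F -> measurable_fun setT F' ->
    (forall t, `|F t| <= K) -> (forall t, `|t| != 1 -> F' t = F (expand t)) ->
    \int[rho]_x F x = \int[P]_x F' (u x).
  move=> mF mF' FK FF'; rewrite /Rintegral; congr fine.
  have mFX : measurable_fun setT (fun x : measurableTypeR R => F (expand (u x))).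
    exact: (measurableT_comp mF mX).
  rewrite integral_distribution; last 2 first.
    exact/measurable_EFinP.
    exact: (bounded_integrable P mFX (fun x => FK _)).
  apply: ae_eq_integral => //.
  - exact/measurable_EFinP.
  - by apply/measurable_EFinP; exact: (measurableT_comp mF' mu_).
  - by apply: filterS aeN => x ux _; rewrite /= FF'.
exists rho => z z0.
have -> : cauchyG rho z = Complex (cauchyRe rho z) (- cauchyIm rho z) by [].
rewrite /cauchyRe /cauchyIm.
rewrite (Idist _ (compactRe (ReC z) (ImC z)) (ImC z)^-1); last 4 first.
- exact: measurable_kernelRe.
- by apply: continuous_measurable_fun; exact: compactRe_continuous.
- by move=> t; exact: kernelRe_le.
- by move=> t t1; exact: compactRe_expand.
rewrite (Idist _ (compactIm (ReC z) (ImC z)) (ImC z)^-1); last 4 first.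
- exact: measurable_kernelIm.
- by apply: continuous_measurable_fun; exact: compactIm_continuous.
- by move=> t; rewrite gtr0_norm ?kernelIm_gt0// kernelIm_le.
- by move=> t t1; exact: compactIm_expand.
by rewrite limRe// limIm// opprK; case: (_^-1).
Qed.

End LimitMeasure.

(** * Existence of monotone convolutions, by discretizing both measures *)

Lemma exists_monotone_conv (R : realType) (sigma nu : probability R R) :
  exists rho, is_monotone_conv sigma nu rho.
Proof.
have [s_ [sp sG]] := exists_seq_approximation sigma.
have [t_ [tp tG]] := exists_seq_approximation nu.
have hw n : exists w, seq_prob w /\ forall z : R[i], upper z ->
    seq_cauchyG w z = seq_cauchyG (s_ n) (seq_cauchyG (t_ n) z)^-1.
  by have [w wp wG] := seq_monotone (sp n) (tp n); exists w.
have [w_ w_P] := choice hw.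
pose H := recipF sigma \o recipF nu.
have asH : asymp_id H := asymp_id_comp (recipF_asymp nu) (recipF_asymp sigma).
have inv_upper (g : R[i]) : ImC g < 0 -> upper g^-1.
  case: g => a b; rewrite /upper /ImC /GRing.inv /= => b0.
  by rewrite oppr_gt0 pmulr_llt0// invr_gt0 -sqrrN ltr_wpDl ?sqr_ge0// -(sqrrN b) exprn_gt0// oppr_gt0.
(* Inversion is continuous at g with Im g < 0; so the reciprocal transforms of the approximations of
   [nu] converge to F_nu(z), a point where the approximations of [sigma] may be evaluated. *)
have inv_cvg (g_ : nat -> R[i]) (g : R[i]) : ImC g < 0 ->
    ReC (g_ n) @[n --> \oo] --> ReC g -> ImC (g_ n) @[n --> \oo] --> ImC g ->
    ReC (g_ n)^-1 @[n --> \oo] --> ReC g^-1 /\ ImC (g_ n)^-1 @[n --> \oo] --> ImC g^-1.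
  move=> g0 cR cI.
  have D0 : ReC g ^+ 2 + ImC g ^+ 2 != 0.
    by rewrite gt_eqF// ltr_wpDl ?sqr_ge0// -sqrrN exprn_gt0// oppr_gt0.
  have cD : (ReC (g_ n) ^+ 2 + ImC (g_ n) ^+ 2)^-1 @[n --> \oo] -->
      (ReC g ^+ 2 + ImC g ^+ 2)^-1.
    apply: cvgV => //; apply: cvgD.
      by apply: (@cvgM _ _ _ _ (fun n => ReC (g_ n)) (fun n => ReC (g_ n))).
    by apply: (@cvgM _ _ _ _ (fun n => ImC (g_ n)) (fun n => ImC (g_ n))).
  have RE (h : R[i]) : ReC h^-1 = ReC h * (ReC h ^+ 2 + ImC h ^+ 2)^-1 by case: h.
  have IE (h : R[i]) : ImC h^-1 = - (ImC h * (ReC h ^+ 2 + ImC h ^+ 2)^-1) by case: h.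
  split; first by rewrite RE; under eq_cvg do rewrite RE; apply: cvgM.
  by rewrite IE; under eq_cvg do rewrite IE; apply: cvgN; apply: cvgM.
have [|rho rhoG] := exists_limit_measure (fun n => (w_P n).1) asH.
  move=> z z0.
  have [cR cI] := tG (fun=> z) z z0 (fun=> z0) (cvg_cst _) (cvg_cst _).
  have G0 : ImC (cauchyG nu z) < 0 by rewrite /ImC /= oppr_lt0; exact: cauchyIm_gt0.
  have [cR' cI'] := inv_cvg _ _ G0 cR cI.
  have up n : upper (seq_cauchyG (t_ n) z)^-1.
    by apply: inv_upper; exact: seq_cauchyG_Im_lt0.
  have [c1 c2] := sG _ _ (recipF_upper nu z0) up cR' cI'.
  have -> : (H z)^-1 = cauchyG sigma (recipF nu z) by rewrite /H /= /recipF invrK.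
  have wE n := (w_P n).2 z z0.
  by split; under eq_cvg do rewrite wE.
exists rho => z z0; rewrite {1}/recipF rhoG// invrK //.
Qed.

(** * The two identities for additive subordination *)

Theorem theorem1p3 (R : realType) :
  (* A_sigma(mu1 [+] mu2) = A_sigma(mu1) [+] A_sigma(mu2) *)
  (forall (mu1 mu2 sigma rho a1 a2 a : probability R R),
      is_free_conv mu1 mu2 rho ->
      is_subord sigma mu1 a1 -> is_subord sigma mu2 a2 ->
      is_subord sigma rho a ->
      is_free_conv a1 a2 a) /\
  (* A_sigma1 (A_sigma2 mu) = A_(sigma2 |> sigma1) mu *)
  (forall (sigma1 sigma2 s mu b a : probability R R),
      is_monotone_conv sigma2 sigma1 s ->
      is_subord sigma2 mu b -> is_subord sigma1 b a ->
      is_subord s mu a).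

Proof.
split.
- move=> mu1 mu2 sigma rho a1 a2 a /is_free_convP[p1 [p2 [v1 v2 v]]].
  move=> [r1 [/is_free_convP[q1 [s1 [w1 u1 t1]]] m1]].
  move=> [r2 [/is_free_convP[q2 [s2 [w2 u2 t2]]] m2]].
  move=> [r3 [/is_free_convP[q3 [s3 [w3 u3 t3]]] m3]].
  have x1 := is_voiculescu_subord m1 w1 u1 t1.
  have x2 := is_voiculescu_subord m2 w2 u2 t2.
  have x3 := is_voiculescu_subord m3 w3 u3 t3.
  apply/is_free_convP; exists (s1 \o recipF sigma), (s2 \o recipF sigma).
  split => //; apply: is_voiculescu_near x3.
  (* Uniqueness turns the free convolution of [mu1] and [mu2] into an identity of transforms, which
     is then composed with F_sigma. *)
  have e : \forall z \near cone_nbhs, s3 z = s1 z + s2 z.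
    have e1 := is_voiculescu_unique v1 u1.
    have e2 := is_voiculescu_unique v2 u2.
    apply: filterS3 e1 e2 (is_voiculescu_unique v u3) => z <- <- <- //.
  exact: (asymp_id_cvg (recipF_asymp sigma) e).
- move=> sigma1 sigma2 s mu b a ms.
  move=> [r [/is_free_convP[p2 [p [v2 v w]]] m]].
  move=> [r2 [/is_free_convP[p1 [q [v1 vb w2]]] m2]].
  (* [r2] is both the free convolution of [sigma1] with [b] and the monotone convolution of [sigma1]
     with [a]. By associativity of composition, F_rho = F_sigma2 o F_sigma1 o F_a = F_s o F_a. *)
  have [rho mr] := exists_monotone_conv sigma2 r2.
  exists rho; split; last first.
    by move=> z z0; rewrite mr// m2// ms//; exact: recipF_upper.
  apply/is_free_convP.
  exists (fun z => p2 z + p1 (z + p2 z)), p; split => //.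
    exact: is_voiculescu_monotone ms v2 v1.
  have [i2 a2 e2] := v2.
  (* The transform of [rho] is p2 + (p1 + q) o (id + p2). As q = p o F_sigma2 and F_sigma2 o (id +
     p2) = id, the term in [q] reduces to [p]. *)
  have := is_voiculescu_monotone mr v2 w2; apply: is_voiculescu_near.
  have H := is_voiculescu_unique vb (is_voiculescu_subord m v2 v w).
  have H' : \forall z \near cone_nbhs, q (z + p2 z) = p (recipF sigma2 (z + p2 z)).
    exact: (asymp_id_cvg a2 H).
  by apply: filterS2 H' e2 => z /= -> ->; rewrite addrA.
Qed.
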